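(* Let $\phi\colon\mathbb{R}^n\to\phi(\mathbb{R}^n)=\mathbb{R}^n$ be a homeomorphism of the form $\phi(\xi)=A(\xi)\xi$ for $\xi\in\mathbb{R}^n\setminus\{0\}$, $\phi(0)=0$, where $A\colon\mathbb{R}^n\setminus\{0\}\to(0,+\infty)$ is continuous, and let $f=f(t,x)\colon[0,T]\times\mathbb{R}^n\to\mathbb{R}^n$ be a continuous function. Let $V\colon\mathbb{R}^n\to\mathbb{R}$ be a $\mathcal{C}^2$-function such that $V'(u)\neq0$ for all $u\in\mathbb{R}^n$ with $V(u)=0$. Let $D:=\{x\in\mathbb{R}^n: V(x)\le0\}$ be nonempty and bounded. Suppose that for every $t\in[0,T]$ and $u\in\partial D$: - $\langle V'(u),f(t,u)\rangle\ge0$; - $\langle V''(u)y,y\rangle\ge0$ for all $y\in\mathbb{R}^n$ with $\langle V'(u),y\rangle=0$. Then the problem $$(\phi(x'))'=f(t,x),\qquad x(0)=x(T),\quad x'(0)=x'(T)$$ has at least one solution with values in $D$.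
   Context: $T>0$ and $n\ge1$ are fixed. $\langle\cdot,\cdot\rangle$ is the standard inner product on $\mathbb{R}^n$; $V'$ denotes the gradient and $V''$ the Hessian matrix of $V$. A solution of the problem is a continuously differentiable function $x\colon[0,T]\to\mathbb{R}^n$ such that $t\mapsto\phi(x'(t))$ is continuously differentiable, the equation holds for all $t\in[0,T]$, and the boundary conditions hold. *)

(* Defs.v *)
From mathcomp Require Import all_boot all_order all_algebra.
From mathcomp Require Import all_classical all_reals all_analysis.

Set Implicit Arguments.
Unset Strict Implicit.
Unset Printing Implicit Defensive.

Import Order.TTheory GRing.Theory Num.Theory.
Import numFieldNormedType.Exports.

Local Open Scope classical_set_scope.
Local Open Scope ring_scope.

Definition dotp (R : realType) (n : nat) (u v : 'rV[R]_n) : R :=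
  \sum_(i < n) u ord0 i * v ord0 i.

Definition homeomorphism (X Y : topologicalType) (h : X -> Y) : Prop :=
  continuous h /\
  exists2 g : Y -> X, cancel h g /\ cancel g h & continuous g.

Definition boundary (X : topologicalType) (D : set X) : set X :=
  closure D `\` D°.

Definition gradient (R : realType) (n : nat) (V : 'rV[R]_n -> R)
    (u : 'rV[R]_n) : 'rV[R]_n :=
  \row_(i < n) 'D_(delta_mx ord0 i) V u.

(* The (i, j) entry is the i-th partial derivative of the j-th partial
   derivative of V; the matrix acts on row vectors from the right. *)
Definition hessian (R : realType) (n : nat) (V : 'rV[R]_n -> R)
    (u : 'rV[R]_n) : 'M[R]_n :=
  'J (gradient V) u.

Definition class_C2 (R : realType) (n : nat) (V : 'rV[R]_n -> R) : Prop :=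
  [/\ forall u, differentiable V u,
      forall u, differentiable (gradient V) u &
      continuous (hessian V)].

(* At the endpoints t = 0 and t = T the limit is one-sided; the values of x
   and dx outside [0, T] are irrelevant. *)
Definition derivative_on (R : realType) (n : nat) (T : R)
    (x dx : R -> 'rV[R]_n) : Prop :=
  forall t, t \in `[0, T] ->
    (s - t)^-1 *: (x s - x t)
      @[s --> within (`[0, T] `\ t) (nbhs t)] --> dx t.

Definition C1_on (R : realType) (n : nat) (T : R)
    (x dx : R -> 'rV[R]_n) : Prop :=
  derivative_on T x dx /\ {within `[0, T], continuous dx}.

Definition periodic_solution (R : realType) (n : nat) (T : R)
    (phi : 'rV[R]_n -> 'rV[R]_n) (f : R -> 'rV[R]_n -> 'rV[R]_n)
    (x : R -> 'rV[R]_n) : Prop :=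
  exists dx w : R -> 'rV[R]_n,
    [/\ C1_on T x dx,
        C1_on T (phi \o dx) w,
        forall t, t \in `[0, T] -> w t = f t (x t),
        x 0 = x T &
        dx 0 = dx T].

(* Main.v *)
Require Import Defs.
From mathcomp Require Import all_boot all_order all_algebra all_fingroup.
From mathcomp Require Import all_classical all_reals all_analysis.
From mathcomp Require Import ring lra zify.

(** Write psi for the inverse of phi.  The equation is the first order system
    x' = psi(y), y' = f(t, x), where psi(y) is a positive multiple of y.

    Reduction to a convex set.  The sublevel set D may be disconnected, but
    its components are convex, because the boundary bends outward wherever a
    line touches it.  Hence D contains a compact convex K whose outward
    normals are positive multiples of the gradient of V, taken at points
    where V vanishes (convex_component).  The delicate point is that the
    curvature is only nonnegative: a segment touching the boundary from
    inside is bent into a parabola, which would then touch it strictly from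
    inside, and this contradicts the sign of the Hessian
    (no_inner_parabola, segment_inside_of_le0).

    Confinement.  Let P be the projection on K, and replace f(t, x) by
    F(t, x) = f(t, P x) + (x - P x).  If x, y is a periodic solution of the
    modified system and x is farthest from K at time s, with
    nu = x(s) - P x(s) nonzero, then <nu, x> is maximal at s, so <nu, x'(s)> = 0
    and hence <nu, y(s)> = 0.  But <nu, y>' = <nu, F> is positive at s, so just
    after s first <nu, y>, then <nu, x'>, is positive: a contradiction
    (periodic_invariance).  So x stays in K, where F = f.

    Existence for the modified system (periodic_system).  Along periodic
    functions the integral of <x', y> + <y', x> vanishes, so pairing the
    two equations with y and x leaves only the integral of
    <psi(y), y> + <F(t, x), x>, which is coercive: F is x plus a bounded
    term.  The semi-implicit Euler scheme keeps this cancellation exactly.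
    Its equations therefore form a continuous vector field in finite
    dimension that does not point inward outside a ball, and such a field
    has a zero (zero_of_outward).  The same identity bounds the discrete
    solutions independently of the mesh (discrete_apriori_bound), and a
    limit along an ultrafilter solves the system (limit_derivative).

    Zeros of vector fields.  They come from the Poincare-Miranda theorem,
    and this from a discrete degree: for functions F_0, ..., F_{m-1} on the
    vertices of a grid, the cup product dF_0 ... dF_{m-1} summed over all
    cells depends only on boundary values (grid_degree_replace, a discrete
    Stokes formula).  With the boundary values 0 and 1 on opposite facets
    the sum is 1, so on some cell no F_k is constant (grid_connector). *)

Set Implicit Arguments.
Unset Strict Implicit.
Unset Printing Implicit Defensive.

Import Order.TTheory GRing.Theory Num.Theory.
Import numFieldNormedType.Exports.

Local Open Scope classical_set_scope.
Local Open Scope ring_scope.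

(** * A discrete degree on grids *)

Section Grid.
Variable m : nat.
Implicit Types (s : 'S_m) (v : {ffun 'I_m -> nat}).

(** The vertex reached after k steps of a monotone path across the unit cell
    at v; s tells at which time the step in each direction is taken. *)
Definition grid_path s v (k : nat) : {ffun 'I_m -> nat} :=
  [ffun j => (v j + (s j < k))%N].

Lemma grid_path_tperm s v (a b : 'I_m) (k : nat) :
  b = a.+1 :> nat -> k != b :> nat ->
  grid_path (s * tperm a b)%g v k = grid_path s v k.
Proof.
move=> ba kb; apply/ffunP => j; rewrite !ffunE permM.
by case: tpermP => // ->; congr (_ + nat_of_bool _)%N; lia.
Qed.

(** Pairing s with s composed with a transposition cancels every quantity
    that does not see the order of two steps. *)
Lemma alternating_sum0 (X : 'S_m -> int) (a b : 'I_m) : a != b ->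
  (forall s, X (s * tperm a b)%g = X s) ->
  \sum_(s : {perm _}) (-1) ^+ (s : bool) * X s = 0.
Proof.
move=> ab Xab; set S := \sum_s _.
suff : S = - S by lia.
rewrite {1}/S (reindex_inj (mulIg (tperm a b))) /= /S -sumrN.
by apply: eq_bigr => s _; rewrite Xab odd_permM odd_tperm ab addbT signrN mulNr.
Qed.

Section Silent.
Variables (F : 'I_m -> {ffun 'I_m -> nat} -> int) (u : {ffun 'I_m -> nat} -> int).
Variable i : 'I_m.

Definition step_diff s v (k : 'I_m) (t : nat) : int :=
  F k (grid_path s v t.+1) - F k (grid_path s v t).

(** A term of the expansion of dF_0 ... du ... dF_{m-1} with u in slot i: the
    step at time p is taken without recording an increment, and the functions
    other than F_i use the remaining steps in order. *)
Definition silent_term (q p : nat) s v : int :=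
  (\prod_(k < m | k != i) step_diff s v k (bump p (unbump i k)))
  * u (grid_path s v q).

(** The terms for p and p + 1 add up to one in which a single function records
    its increment over two consecutive steps; the order of these two steps is
    then invisible, so the alternating sum vanishes.  This is the rule that
    the differential D and dF anticommute, because D D = 0. *)
Lemma silent_move (q p : nat) v : (p.+1 < m)%N -> q != p.+1 ->
  \sum_(s : {perm _}) (-1) ^+ (s : bool) * silent_term q p.+1 s v =
  - \sum_(s : {perm _}) (-1) ^+ (s : bool) * silent_term q p s v.
Proof.
move=> pm qp; apply/eqP; rewrite -subr_eq0 opprK -big_split /=; apply/eqP.
have pm' : (p < m)%N by lia.
pose a := Ordinal pm'; pose b := Ordinal pm.
have k0m : (bump i p < m)%N by rewrite /bump; lia.
pose k0 := Ordinal k0m.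
have k0i : k0 != i by rewrite -val_eqE /= eq_sym neq_bump.
pose X s := (F k0 (grid_path s v p.+2) - F k0 (grid_path s v p)) *
  (\prod_(k < m | (k != i) && (k != k0)) step_diff s v k (bump p (unbump i k)))
  * u (grid_path s v q).
rewrite -[RHS](@alternating_sum0 X a b).
- apply: eq_bigr => s _; rewrite -mulrDr; congr (_ * _).
  rewrite /silent_term /X (bigD1 k0) //= [in X in _ + X](bigD1 k0) //= bumpK.
  rewrite (eq_bigr (fun k : 'I_m => step_diff s v k (bump p (unbump i k)))).
    rewrite /step_diff /bump leqnn ltnn /= add1n add0n.
    set P := \prod_(_ < _ | _) _; set U := u _; lia.
  move=> k /andP[ki kk0]; congr step_diff.
  have : unbump i k <> p.
    move=> e; move/eqP: kk0; apply; apply: val_inj => /=; rewrite -e unbumpK //.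
  by rewrite /bump; lia.
- by rewrite -val_eqE /=; lia.
move=> s; rewrite /X !(@grid_path_tperm s v a b) //=; try lia.
congr (_ * _ * _); apply: eq_bigr => k /andP[ki kk0].
have : unbump i k <> p.
  move=> e; move/eqP: kk0; apply; apply: val_inj => /=; rewrite -e unbumpK //.
rewrite /step_diff /bump => h.
by rewrite !(@grid_path_tperm s v a b) //=; lia.
Qed.

Lemma silent_moves (q p r : nat) v : (p + r < m)%N ->
  (forall t, (p < t)%N -> (t <= p + r)%N -> t != q) ->
  \sum_(s : {perm _}) (-1) ^+ (s : bool) * silent_term q (p + r) s v =
  (-1) ^+ r * \sum_(s : {perm _}) (-1) ^+ (s : bool) * silent_term q p s v.
Proof.
elim: r => [|r IH] pr tq; first by rewrite addn0 expr0 mul1r.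
rewrite addnS silent_move; first last.
- by rewrite eq_sym; apply: tq; lia.
- by lia.
rewrite IH ?exprS ?mulN1r ?mulNr //; first by lia.
by move=> t h1 h2; apply: tq; lia.
Qed.

End Silent.
End Grid.

Definition grid_point (m N : nat) (v : {ffun 'I_m -> 'I_N}) : {ffun 'I_m -> nat} :=
  [ffun j => nat_of_ord (v j)].

Definition shift_point (m : nat) (d : 'I_m) (v : {ffun 'I_m -> nat}) :=
  [ffun j => (v j + (j == d))%N].

(** Summing f over the cells and over their translates by one step counts the
    same vertices, up to those on two opposite facets, where f vanishes. *)
Lemma sum_shift (m N : nat) (d : 'I_m) (f : {ffun 'I_m -> nat} -> int) :
  (forall v : {ffun 'I_m -> nat}, v d = 0%N \/ v d = N -> f v = 0) ->
  \sum_(v : {ffun 'I_m -> 'I_N}) f (shift_point d (grid_point v)) =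
  \sum_(v : {ffun 'I_m -> 'I_N}) f (grid_point v).
Proof.
move=> f0.
pose h (v : {ffun 'I_m -> 'I_N}) :=
  [ffun j => if j == d then ordS (v j) else v j].
have hI : injective h.
  move=> v w /ffunP e; apply/ffunP => j; move: (e j); rewrite !ffunE.
  by case: eqP => // _ /ordS_inj.
rewrite [RHS](reindex_inj hI) /=; apply: eq_bigr => v _.
case: (ltnP (v d).+1 N) => vN.
  congr f; apply/ffunP => j; rewrite !ffunE; case: eqP => [->|_].
    by rewrite /= modn_small ?addn1.
  by rewrite addn0.
have e : (v d).+1 = N by have := ltn_ord (v d); lia.
rewrite !f0 //; [left|right]; rewrite !ffunE eqxx /=.
  by rewrite e modnn.
by rewrite addn1.
Qed.

(** Rotating the times makes the first step of a path the last one; what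
    remains is a path started one step further. *)
Lemma grid_path_cycle (m : nat) (s : 'S_m.+1) (v : {ffun 'I_m.+1 -> nat}) (k : nat) :
  (k <= m)%N ->
  grid_path (s * lift_perm ord_max ord0 1)%g v k.+1 =
  grid_path s (shift_point (s^-1 ord_max)%g v) k.
Proof.
move=> km; apply/ffunP => j; rewrite !ffunE permM -addnA; congr (_ + _)%N.
rewrite -(inj_eq (@perm_inj _ s)) permKV.
case: (unliftP ord_max (s j)) => [l ->|->].
  rewrite lift_perm_lift perm1 /= /bump /= [in RHS]eq_sym (negbTE (neq_lift _ _)).
  by have := ltn_ord l; lia.
by rewrite lift_perm_id eqxx /=; lia.
Qed.

(** The evaluation on the whole grid of the cup product dF_0 ... dF_{m-1},
    the discrete counterpart of the integral of the Jacobian determinant. *)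
Definition grid_degree (m N : nat) (F : 'I_m -> {ffun 'I_m -> nat} -> int) : int :=
  \sum_(v : {ffun 'I_m -> 'I_N}) \sum_(s : 'S_m) (-1) ^+ (s : bool) *
    \prod_(k < m) step_diff F s (grid_point v) k k.

Definition facet_labelled (m N : nat) (d : 'I_m) (f : {ffun 'I_m -> nat} -> int) :=
  (forall v : {ffun 'I_m -> nat}, v d = 0%N -> f v = 0) /\
  (forall v : {ffun 'I_m -> nat}, v d = N -> f v = 1).

(** Discrete Stokes formula.  With u = F_i - G_i, the term with du in slot i is
    a difference of two silent terms.  Moving the silent step of the first to
    the beginning and that of the second to the end makes them equal up to a
    translation in a direction d, so their difference telescopes to the facets
    orthogonal to d.  There it vanishes: through u when d = i, and through the
    increment of F_d, which is constant on these facets, when d differs from i. *)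
Lemma grid_degree_replace (m N : nat) (F G : 'I_m -> {ffun 'I_m -> nat} -> int) (i : 'I_m) :
  (forall d, facet_labelled N d (F d)) -> facet_labelled N i (G i) ->
  (forall k, k != i -> G k = F k) ->
  grid_degree N F = grid_degree N G.
Proof.
move: F G i; case: m => [? ? [] //|m] F G i Fb Gb FG.
pose u v := F i v - G i v.
have ub (v : {ffun 'I_m.+1 -> nat}) : v i = 0%N \/ v i = N -> u v = 0.
  by rewrite /u; case=> h; [rewrite (Fb i).1 // Gb.1|rewrite (Fb i).2 // Gb.2];
     rewrite // subrr.
have bump_ii (k : 'I_m.+1) : k != i -> bump i (unbump i k) = k.
  by move=> ki; rewrite unbumpK.
apply/eqP; rewrite -subr_eq0 /grid_degree -sumrB.
under eq_bigr => v _.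
  rewrite -sumrB.
  under eq_bigr => s _.
    rewrite -mulrBr (bigD1 i) //= [in X in _ - X](bigD1 i) //=.
    rewrite [X in _ - _ * X](eq_bigr (fun k : 'I_m.+1 =>
      step_diff F s (grid_point v) k (bump i (unbump i k)))); last first.
      by move=> k ki; rewrite /step_diff FG // bump_ii.
    rewrite (eq_bigr (fun k : 'I_m.+1 =>
      step_diff F s (grid_point v) k (bump i (unbump i k)))); last first.
      by move=> k ki; rewrite bump_ii.
    rewrite (_ : _ - _ = silent_term F u i i.+1 i s (grid_point v)
                       - silent_term F u i i i s (grid_point v)); last first.
      rewrite /silent_term /u /step_diff; set P := \prod_(_ < _ | _) _.
      by lia.
    rewrite mulrBr.
    over.
  rewrite sumrB.
  have := @silent_moves _ F u i i.+1 0 i (grid_point v).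
  rewrite add0n => ->; [|by []|by move=> t _ ti; lia].
  have := @silent_moves _ F u i i i (m - i) (grid_point v).
  have im : (i <= m)%N by rewrite -ltnS.
  rewrite subnKC // => /(_ (leqnn _) _) hm.
  have -> : \sum_(s : {perm _}) (-1) ^+ (s : bool) * silent_term F u i i i s (grid_point v) =
      (-1) ^+ (m - i) * \sum_(s : {perm _}) (-1) ^+ (s : bool) * silent_term F u i i m s (grid_point v).
    rewrite hm => [|t]; last by lia.
    by rewrite mulrA -expr2 sqrr_sign mul1r.
  (* The cyclic permutation of the times, of sign (-1) ^ m, turns a silent
     first step into a silent last step. *)
  rewrite (reindex_inj (mulIg (lift_perm ord_max ord0 1))) /=.
  rewrite (eq_bigr (fun s : 'S_m.+1 => (-1) ^+ m * ((-1) ^+ (s : bool) *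
     silent_term F u i i m s (shift_point (s^-1 ord_max)%g (grid_point v))))); last first.
    move=> s _; rewrite odd_permM odd_lift_perm odd_perm1 /= addbF addbF.
    rewrite mulrA; congr (_ * _).
      by rewrite signr_addb mulrC signr_odd.
    rewrite /silent_term grid_path_cycle; last by rewrite -ltnS.
    congr (_ * _); apply: eq_bigr => k ki.
    have kl : (unbump i k < m)%N.
      by have := ltn_ord k; have := ltn_ord i; have := ki; rewrite -val_eqE /= /unbump; lia.
    have -> : bump 0 (unbump i k) = (unbump i k).+1 by rewrite /bump; lia.
    have -> : bump m (unbump i k) = unbump i k by rewrite /bump; lia.
    by rewrite /step_diff !grid_path_cycle //; lia.
  rewrite -mulr_sumr mulrA -exprD.
  have -> : (-1) ^+ (i + m) = (-1) ^+ (m - i) :> int.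
    by rewrite -signr_odd -[RHS]signr_odd oddB // oddD addbC.
  rewrite -mulrBr -sumrB.
  under eq_bigr => s _ do rewrite -mulrBr.
  over.
rewrite -mulr_sumr exchange_big /= big1 ?mulr0 // => s _.
rewrite -mulr_sumr sumrB sum_shift ?subrr ?mulr0 // => v vd.
set d := (s^-1 ord_max)%g in vd.
(* Direction d is taken at the last time, so the path stays in a facet
   before that. *)
have stay k : (k <= m)%N -> grid_path s v k d = v d.
  by move=> km; rewrite ffunE permKV /= ltnNge km addn0.
rewrite /silent_term; have [di|di] := eqVneq d i.
  rewrite [u _]ub ?mulr0 // -di !stay //; first by rewrite di -ltnS.
rewrite (bigD1 d) //= [step_diff _ _ _ _ _](_ : _ = 0) ?mul0r //.
have dl : (unbump i d < m)%N.
  by have := ltn_ord d; have := ltn_ord i; have := di; rewrite -val_eqE /= /unbump; lia.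
have -> : bump m (unbump i d) = unbump i d by rewrite /bump; lia.
rewrite /step_diff; case: vd => vd.
  by rewrite !(Fb d).1 ?subrr // stay // ltnW.
by rewrite !(Fb d).2 ?subrr // stay // ltnW.
Qed.

Lemma grid_degree_eq (m N : nat) (F G : 'I_m -> {ffun 'I_m -> nat} -> int) :
  (forall d, facet_labelled N d (F d)) -> (forall d, facet_labelled N d (G d)) ->
  grid_degree N F = grid_degree N G.
Proof.
move=> Fb Gb.
pose H (t : nat) (k : 'I_m) := if (k < t)%N then G k else F k.
have Hb t d : facet_labelled N d (H t d) by rewrite /H; case: ifP.
suff HF t : (t <= m)%N -> grid_degree N (H t) = grid_degree N F.
  rewrite -(HF m) //; apply: eq_bigr => v _; apply: eq_bigr => s _.
  by congr (_ * _); apply: eq_bigr => k _; rewrite /step_diff /H ltn_ord.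
elim: t => [_|t IH tm].
  apply: eq_bigr => v _; apply: eq_bigr => s _.
  by congr (_ * _); apply: eq_bigr => k _; rewrite /step_diff /H ltn0.
rewrite -IH; last exact: ltnW.
apply: esym; apply: (@grid_degree_replace _ _ _ _ (Ordinal tm)) => // k.
rewrite -val_eqE /= /H => kt; rewrite ltnS leq_eqVlt (negbTE kt) //.
Qed.

(** Only the cell at the origin, crossed in the order 0, 1, ..., m - 1, has a
    product of increments different from 0. *)
Lemma grid_degree_positive (m N : nat) : (0 < N)%N ->
  grid_degree N (fun (k : 'I_m) v => (0 < v k)%N : int) = 1.
Proof.
case: N => // N _; rewrite /grid_degree.
rewrite (bigD1 [ffun=> ord0]) //= [X in _ + X]big1 ?addr0; last first.
  move=> v v0; apply: big1 => s _.
  have [k vk] : exists k, v k != ord0.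
    apply/existsP; apply: contraNT v0 => /existsPn h.
    by apply/eqP/ffunP => k; rewrite ffunE; apply/eqP; rewrite -[_ == _]negbK h.
  rewrite (bigD1 k) //= /step_diff !ffunE -!val_eqE /= in vk *.
  by rewrite !ltn_addr ?subrr ?mul0r ?mulr0 // lt0n.
rewrite (bigD1 1%g) //= [X in _ + X]big1 ?addr0; last first.
  move=> s s1; have [k sk] : exists k, s k != k.
    apply/existsP; apply: contraNT s1 => /existsPn h.
    by apply/eqP/permP => k; rewrite perm1; apply/eqP; rewrite -[_ == _]negbK h.
  rewrite (bigD1 k) //= /step_diff !ffunE !add0n -!val_eqE /= in sk *.
  have -> : (s k < k.+1)%N = (s k < k)%N by lia.
  by rewrite subrr mul0r mulr0.
rewrite odd_perm1 expr0 mul1r big1 // => k _.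
by rewrite /step_diff !ffunE !perm1 ltnS leqnn ltnn.
Qed.

(** A cell with a nonzero term in the degree has, for each k, an edge along
    which F_k changes. *)
Lemma grid_connector (m N : nat) (F : 'I_m -> {ffun 'I_m -> nat} -> bool) :
  (0 < N)%N ->
  (forall d (v : {ffun 'I_m -> nat}), v d = 0%N -> F d v = false) ->
  (forall d (v : {ffun 'I_m -> nat}), v d = N -> F d v = true) ->
  exists2 v : {ffun 'I_m -> nat}, forall j, (v j <= N)%N &
    forall k : 'I_m, exists w w' : {ffun 'I_m -> nat},
    [/\ forall j, (v j <= w j <= N)%N && (w j <= (v j).+1)%N,
        forall j, (v j <= w' j <= N)%N && (w' j <= (v j).+1)%N,
        F k w = true & F k w' = false].
Proof.
move=> N0 F0 F1.
pose G (k : 'I_m) v : int := (F k v : nat)%:Z.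
have deg1 : grid_degree N G = 1.
  rewrite -(@grid_degree_positive m N) //; apply: grid_degree_eq => d; split=> v h.
  - by rewrite /G F0.
  - by rewrite /G F1.
  - by rewrite h.
  - by rewrite h N0.
have [v hv] : exists v : {ffun 'I_m -> 'I_N},
    \sum_(s : 'S_m) (-1) ^+ (s : bool) *
    \prod_(k < m) step_diff G s (grid_point v) k k != 0.
  apply/existsP; rewrite -negb_forall; apply/negP => /forallP h.
  by move: deg1; rewrite /grid_degree big1 // => v _; apply/eqP.
have [s hs] : exists s : 'S_m,
    \prod_(k < m) step_diff G s (grid_point v) k k != 0.
  apply/existsP; rewrite -negb_forall; apply: contra hv => /forallP h.
  by rewrite big1 // => s _; rewrite (eqP (h s)) mulr0.
exists (grid_point v) => [j|k]; first by rewrite ffunE ltnW.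
have : step_diff G s (grid_point v) k k != 0 by move/prodf_neq0: hs; apply.
have inb t j : (grid_point v j <= grid_path s (grid_point v) t j <= N)%N &&
    (grid_path s (grid_point v) t j <= (grid_point v j).+1)%N.
  by rewrite !ffunE; have := ltn_ord (v j); case: (s j < t)%N; rewrite ?addn0 ?addn1; lia.
rewrite /step_diff /G.
case E1 : (F k _); case E2 : (F k _) => //= _.
  by exists (grid_path s (grid_point v) k.+1), (grid_path s (grid_point v) k).
by exists (grid_path s (grid_point v) k), (grid_path s (grid_point v) k.+1).
Qed.

(** * The inner product on row vectors *)

Section RowVectors.
Variables (R : realType) (n : nat).
Implicit Types x y : 'rV[R]_n.

Lemma norm_coord_le x j : `|x 0 j| <= `|x|.
Proof.
rewrite /Num.Def.normr /= mx_normrE.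
by apply: (le_bigmax _ (fun ij : 'I_1 * 'I_n => `|x ij.1 ij.2|) (0, j)).
Qed.

Lemma norm_rV_le x (c : R) : 0 <= c -> (forall j, `|x 0 j| <= c) -> `|x| <= c.
Proof.
move=> c0 h; rewrite /Num.Def.normr /= mx_normrE.
by apply: bigmax_le => // -[i j] _ /=; rewrite (ord1 i).
Qed.

Lemma cvg_rV (T : Type) (F : set_system T) {FF : Filter F} (f : T -> 'rV[R]_n) (l : 'rV[R]_n) :
  (forall j, (fun t => f t 0 j) @ F --> l 0 j) -> f @ F --> l.
Proof.
move=> h; apply/cvgrPdist_le => e e0.
have H : F (fun t => forall j, `|l 0 j - f t 0 j| <= e).
  by apply: filter_forall => j; move/cvgrPdist_le: (h j) => /(_ e e0).
apply: filterS H => t ht.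
apply: norm_rV_le => [|j]; first exact: ltW.
by rewrite !mxE; apply: ht.
Qed.

Lemma cvg_coord (T : Type) (F : set_system T) {FF : Filter F} (f : T -> 'rV[R]_n) (l : 'rV[R]_n) j :
  f @ F --> l -> (fun t => f t 0 j) @ F --> l 0 j.
Proof.
move=> h; apply: (@cvg_comp _ _ _ f (fun M : 'rV[R]_n => M 0 j) _ _ _ h).
exact: coord_continuous.
Qed.

Lemma cvg_dotp (T : Type) (F : set_system T) {FF : Filter F} (f g : T -> 'rV[R]_n) (u v : 'rV[R]_n) :
  f @ F --> u -> g @ F --> v -> (fun t => dotp (f t) (g t)) @ F --> dotp u v.
Proof.
move=> fu gv; rewrite /dotp; apply: cvg_big => [|i _]; first exact: add_continuous.
by apply: cvgM; apply: cvg_coord.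
Qed.

Lemma dotpC x y : dotp x y = dotp y x.
Proof. by apply: eq_bigr => i _; rewrite mulrC. Qed.

Lemma dotpDr x y z : dotp x (y + z) = dotp x y + dotp x z.
Proof. by rewrite /dotp -big_split; apply: eq_bigr => i _; rewrite mxE mulrDr. Qed.

Lemma dotpZr (a : R) x y : dotp x (a *: y) = a * dotp x y.
Proof. by rewrite /dotp mulr_sumr; apply: eq_bigr => i _; rewrite mxE mulrCA. Qed.

Lemma dotpNr x y : dotp x (- y) = - dotp x y.
Proof. by rewrite -scaleN1r dotpZr mulN1r. Qed.

Lemma dotpBr x y z : dotp x (y - z) = dotp x y - dotp x z.
Proof. by rewrite dotpDr dotpNr. Qed.

Lemma dotpDl x y z : dotp (y + z) x = dotp y x + dotp z x.
Proof. by rewrite !(dotpC _ x) dotpDr. Qed.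

Lemma dotpZl (a : R) x y : dotp (a *: y) x = a * dotp y x.
Proof. by rewrite !(dotpC _ x) dotpZr. Qed.

Lemma dotpNl x y : dotp (- y) x = - dotp y x.
Proof. by rewrite !(dotpC _ x) dotpNr. Qed.

Lemma dotpBl x y z : dotp (y - z) x = dotp y x - dotp z x.
Proof. by rewrite dotpDl dotpNl. Qed.

Lemma dotp0r x : dotp x 0 = 0.
Proof. by rewrite -(scale0r 0) dotpZr mul0r. Qed.

Definition dotpE := (dotpDr, dotpDl, dotpBr, dotpBl, dotpNr, dotpNl, dotpZr, dotpZl).

Lemma dotp_ge0 x : 0 <= dotp x x.
Proof. by apply: sumr_ge0 => i _; rewrite -expr2 sqr_ge0. Qed.

Lemma norm_sq_le_dotp x : `|x| ^+ 2 <= dotp x x.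
Proof.
have [->|x0] := eqVneq x 0; first by rewrite normr0 expr0n dotp_ge0.
have := @mx_norm_neq0 R 1 n x; rewrite -/(`|x|) => h.
have : mx_norm x != 0 by move: x0; rewrite -normr_eq0.
move=> /mx_norm_neq0[[i j] /= e].
have -> : `|x| = `|x i j| by exact: e.
rewrite (ord1 i) /dotp (bigD1 j) //= -normrX ger0_norm ?sqr_ge0 // -expr2.
by rewrite lerDl; apply: sumr_ge0 => k _; rewrite -expr2 sqr_ge0.
Qed.

Lemma dotp_eq0 x : (dotp x x == 0) = (x == 0).
Proof.
apply/idP/idP => [/eqP h|/eqP->]; last by rewrite dotp0r.
rewrite -normr_eq0 -sqrf_eq0 eq_le sqr_ge0 andbT -h; exact: norm_sq_le_dotp.
Qed.

Lemma dotp_gt0 x : (0 < dotp x x) = (x != 0).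
Proof. by rewrite lt0r dotp_eq0 dotp_ge0 andbT. Qed.

(** This form of the Cauchy-Schwarz inequality avoids square roots. *)
Lemma dotp_amgm x y : dotp x y *+ 2 <= dotp x x + dotp y y.
Proof.
by have := dotp_ge0 (x - y); rewrite !dotpE (dotpC y x); lra.
Qed.

Lemma dotp_subZ x y (t : R) : dotp (x - t *: y) (x - t *: y) =
  dotp x x - 2 * t * dotp x y + t ^+ 2 * dotp y y.
Proof. by rewrite !dotpE (dotpC y x); ring. Qed.

Lemma compact_norm_ball (M : R) : compact [set x : 'rV[R]_n | `|x| <= M].
Proof.
apply: bounded_closed_compact.
  by exists M; split; rewrite ?num_real // => r Mr x /= xM; apply: le_trans xM (ltW _).
apply: (@closed_comp _ _ (fun x : 'rV[R]_n => `|x|) [set r | r <= M]).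
  by move=> x _; apply: norm_continuous.
exact: closed_le.
Qed.

End RowVectors.

(** * Zeros of outward pointing vector fields *)

Section Zeros.
Variable R : realType.

(** The labels record the sign of H_k, except that they are forced to 0 and 1
    on the two facets orthogonal to direction k, where the boundary hypothesis
    says that this is a correct sign. *)
Lemma grid_zero_approx (m : nat) (M : R) (H : 'rV[R]_m -> 'rV[R]_m) (N : nat) :
  0 < M -> (0 < N)%N ->
  (forall (z : 'rV[R]_m) i, `|z| <= M -> z 0 i = M -> 0 <= H z 0 i) ->
  (forall (z : 'rV[R]_m) i, `|z| <= M -> z 0 i = - M -> H z 0 i <= 0) ->
  exists2 a : 'rV[R]_m, `|a| <= M & forall i, exists p q : 'rV[R]_m,
    [/\ `|p - a| <= 2 * M / N%:R, `|q - a| <= 2 * M / N%:R,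
        0 <= H p 0 i & H q 0 i <= 0].
Proof.
move=> M0 N0 Hp Hn.
have NR : 0 < N%:R :> R by rewrite ltr0n.
pose c := 2 * M / N%:R.
have c0 : 0 < c by rewrite divr_gt0 // mulr_gt0.
have cN : c * N%:R = 2 * M by rewrite /c divfK // gt_eqF.
pose pos (w : {ffun 'I_m -> nat}) : 'rV[R]_m := \row_j (c * (w j)%:R - M).
have posM (w : {ffun 'I_m -> nat}) : (forall j, (w j <= N)%N) -> `|pos w| <= M.
  move=> wN; apply: norm_rV_le => [|j]; first exact: ltW.
  have h1 : (w j)%:R <= N%:R :> R by rewrite ler_nat.
  have h2 : 0 <= (w j)%:R :> R by rewrite ler0n.
  rewrite mxE ler_norml; nra.
have posB (w v : {ffun 'I_m -> nat}) : (forall j, (v j <= w j)%N && (w j <= (v j).+1)%N) ->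
    `|pos w - pos v| <= c.
  move=> wv; apply: norm_rV_le => [|j]; first exact: ltW.
  have /andP[h1 h2] := wv j.
  have {}h1 : (v j)%:R <= (w j)%:R :> R by rewrite ler_nat.
  have {}h2 : (w j)%:R <= (v j)%:R + 1 :> R by rewrite natr1 ler_nat.
  rewrite !mxE ler_norml; nra.
pose F (k : 'I_m) (w : {ffun 'I_m -> nat}) :=
  (w k == N) || ((w k != 0%N) && (0 < H (pos w) 0 k)).
have [d v vd|d v vd|v vN hv] := @grid_connector m N F N0.
- by rewrite /F vd eqxx orbF; apply/eqP; lia.
- by rewrite /F vd eqxx.
exists (pos v) => [|i]; first exact: posM.
have [w [w' [wv w'v Fw Fw']]] := hv i.
have wN j : (w j <= N)%N by have /andP[/andP[]] := wv j.
have w'N j : (w' j <= N)%N by have /andP[/andP[]] := w'v j.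
exists (pos w), (pos w'); split.
- by apply: posB => j; have /andP[/andP[-> _] ->] := wv j.
- by apply: posB => j; have /andP[/andP[-> _] ->] := w'v j.
- case/orP: Fw => [/eqP wiN|/andP[_ /ltW//]].
  by apply: Hp; [exact: posM|rewrite mxE wiN cN; lra].
move/negbT: Fw'; rewrite /F negb_or negb_and negbK => /andP[_ /orP[/eqP w0|]].
  by apply: Hn; [exact: posM|rewrite mxE w0; lra].
by rewrite -leNgt.
Qed.

(** A cluster point of the cells found on finer and finer grids sees both signs
    of every coordinate of H arbitrarily close to it. *)
Theorem poincare_miranda (m : nat) (M : R) (H : 'rV[R]_m -> 'rV[R]_m) :
  0 < M -> continuous H ->
  (forall (z : 'rV[R]_m) i, `|z| <= M -> z 0 i = M -> 0 <= H z 0 i) ->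
  (forall (z : 'rV[R]_m) i, `|z| <= M -> z 0 i = - M -> H z 0 i <= 0) ->
  exists2 z : 'rV[R]_m, `|z| <= M & H z = 0.
Proof.
move=> M0 Hc Hp Hn.
have /choice[a ha] : forall N : nat, exists a : 'rV[R]_m,
    `|a| <= M /\ forall i, exists p q : 'rV[R]_m,
    [/\ `|p - a| <= 2 * M / N.+1%:R, `|q - a| <= 2 * M / N.+1%:R,
        0 <= H p 0 i & H q 0 i <= 0].
  by move=> N; have [a] := grid_zero_approx M0 (ltn0Sn N) Hp Hn; exists a.
have [|z [zM zc]] := @compact_norm_ball R m M (a @ \oo) (fmap_proper_filter _ eventually_filter).
  by exists 0%N => // N _ /=; exact: (ha N).1.
exists z => //.
have near_z (e : R) : 0 < e -> exists N : nat, `|a N - z| < e /\ 2 * M / N.+1%:R < e.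
  move=> e0.
  have h1 : (a @ \oo) [set a N | N in [set N : nat | 2 * M / N.+1%:R < e]].
    have d0 : 0 < e / (2 * M) by rewrite divr_gt0 // mulr_gt0.
    have [K _ hK] := near_infty_natSinv_lt (PosNum d0).
    exists K => // N /= KN; exists N => //=.
    by have := hK N KN; rewrite /= ltr_pdivlMr ?mulr_gt0 // mulrC.
  have h2 : nbhs z (ball z e) by exact: nbhsx_ballx.
  have [_ [[N hN <-]]] := zc _ _ h1 h2.
  rewrite -ball_normE /= distrC => h; by exists N.
have coordc i : {for z, continuous (fun x => H x 0 i)}.
  exact: (@cvg_coord R m _ (nbhs z) _ H (H z) i (Hc z)).
apply/rowP => i; rewrite [RHS]mxE; apply/eqP; rewrite eq_le; apply/andP; split.
  rewrite leNgt; apply/negP => Hz.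
  have : \forall x \near z, 0 < H x 0 i by apply: (cvgr_gt _ (coordc i)).
  move=> /nbhs_ballP[e /= e0 he].
  have [N [h1 h2]] := near_z (e / 2) (divr_gt0 e0 (ltr0n _ 2)).
  have [p [q [/le_lt_trans/(_ h2) pa /le_lt_trans/(_ h2) qa Hp0 Hq0]]] := (ha N).2 i.
  have hb : `|z - q| < e.
  by have := ler_normD (z - a N) (a N - q); rewrite addrA subrK (distrC z (a N)) (distrC (a N) q); lra.
suff : 0 < H q 0 i by lra.
by apply: he; rewrite -ball_normE.
rewrite leNgt; apply/negP => Hz.
have : \forall x \near z, H x 0 i < 0 by apply: (cvgr_lt _ (coordc i)).
move=> /nbhs_ballP[e /= e0 he].
have [N [h1 h2]] := near_z (e / 2) (divr_gt0 e0 (ltr0n _ 2)).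
have [p [q [/le_lt_trans/(_ h2) pa /le_lt_trans/(_ h2) qa Hp0 Hq0]]] := (ha N).2 i.
have hb : `|z - p| < e.
  by have := ler_normD (z - a N) (a N - p); rewrite addrA subrK (distrC z (a N)) (distrC (a N) p); lra.
suff : H p 0 i < 0 by lra.
by apply: he; rewrite -ball_normE.
Qed.

(** Apply the Poincare-Miranda theorem to H(z) = G(rho z) + (z - rho z), where
    rho is the radial retraction on the ball of radius r.  The bounded term
    G(rho z) is dominated on a large cube.  A zero outside the ball would make
    G(rho z) a negative multiple of rho z. *)
Lemma zero_of_outward (m : nat) (r : R) (G : 'rV[R]_m -> 'rV[R]_m) :
  0 < r -> continuous G ->
  (forall z : 'rV[R]_m, r <= `|z| -> 0 <= dotp (G z) z) -> exists z, G z = 0.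
Proof.
move=> r0 Gc Gout.
pose th (z : 'rV[R]_m) : R := r / Num.max r `|z|.
have max_gt0 (z : 'rV[R]_m) : 0 < Num.max r `|z| by rewrite lt_max r0.
have th0 z : 0 < th z by rewrite divr_gt0.
have th1 z : th z <= 1 by rewrite ler_pdivrMr // mul1r le_max lexx.
pose rho (z : 'rV[R]_m) := th z *: z.
have rho_norm z : `|rho z| <= r.
  rewrite normrZ gtr0_norm // /th mulrAC ler_pdivrMr // ler_pM2l //.
  by rewrite le_max lexx orbT.
have rho_c : continuous rho.
  move=> z.
  have mc : Num.max r `|y| @[y --> z] --> Num.max r `|z|.
    apply: (@continuous_max R _ (fun=> r) (fun z : 'rV[R]_m => `|z|) z).
      by apply: (@cvg_cst _ _ _ (nbhs z)).
    by apply: (@norm_continuous R 'rV[R]_m).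
  have thc : th y @[y --> z] --> th z.
    have ic : (Num.max r `|y|)^-1 @[y --> z] --> (Num.max r `|z|)^-1.
      by apply: (cvgV _ mc); rewrite gt_eqF.
    exact: (cvgM (cvg_cst r) ic).
  exact: (cvgZ thc cvg_id).
have Grho_c : continuous (fun z => G (rho z)).
  by move=> z; apply: (@cvg_comp _ _ _ rho G _ _ _ (rho_c z)); apply: Gc.
have [B [_ HB]] : bounded_set (G @` [set z : 'rV[R]_m | `|z| <= r]).
  apply: compact_bounded; apply: continuous_compact; last exact: compact_norm_ball.
  by apply: continuous_subspaceT.
pose C := `|B| + 1.
have GC z : `|G (rho z)| <= C.
  apply: (HB C); last by exists (rho z) => //=; apply: rho_norm.
  by rewrite /C; have := ler_norm B; lra.
have C0 : 0 < C by rewrite /C; have := normr_ge0 B; lra.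
have rhoM z i : `|rho z 0 i| <= r by apply: le_trans (rho_norm z); apply: norm_coord_le.
have HE z i : (G (rho z) + (z - rho z)) 0 i = G (rho z) 0 i + (z 0 i - rho z 0 i).
  by rewrite [LHS]mxE [X in _ + X]mxE [X in _ + (_ + X)]mxE.
have [||z i zM zi|z i zM zi|z zM] := @poincare_miranda m (r + C) (fun z => G (rho z) + (z - rho z)).
- by rewrite addr_gt0.
- by move=> z; exact: (cvgD (Grho_c z) (cvgB cvg_id (rho_c z))).
- rewrite HE zi; have := rhoM z i; have := le_trans (norm_coord_le (G (rho z)) i) (GC z).
  by rewrite !ler_norml; lra.
- rewrite HE zi; have := rhoM z i; have := le_trans (norm_coord_le (G (rho z)) i) (GC z).
  by rewrite !ler_norml; lra.
move=> hz; exists (rho z).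
have [zr|zr] := leP `|z| r.
  have rz : rho z = z by rewrite /rho /th max_l // divff ?scale1r // gt_eqF.
  by move: hz; rewrite rz subrr addr0.
exfalso.
have thE : th z < 1.
  by rewrite /th max_r ?ltW // ltr_pdivrMr ?mul1r // (lt_trans r0).
have nrho : `|rho z| = r.
  by rewrite normrZ gtr0_norm // /th max_r ?ltW // divfK // gt_eqF // (lt_trans r0).
have zn0 : z != 0 by rewrite -normr_gt0 (lt_trans r0).
have := Gout (rho z); rewrite nrho lexx => /(_ isT).
have -> : G (rho z) = - (z - rho z) by apply/eqP; rewrite -addr_eq0 hz.
rewrite /rho !dotpE; have := dotp_gt0 z; rewrite zn0 => h.
have : 0 < (1 - th z) * (th z * dotp z z) by rewrite mulr_gt0 ?subr_gt0 // mulr_gt0.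
by lra.
Qed.
End Zeros.

(** * The time-discretized periodic system *)

Section DiscreteProblem.
Variables (R : realType) (n N : nat) (h C : R).
Variables (psi : 'rV[R]_n -> 'rV[R]_n) (F : nat -> 'rV[R]_n -> 'rV[R]_n).
Hypotheses (h_gt0 : 0 < h) (psi_cont : continuous psi).
Hypothesis F_cont : forall k, continuous (F k).
Hypothesis psi_coercive : forall y, `|y| - C <= dotp (psi y) y.
Hypothesis F_coercive : forall k x, `|x| - C <= dotp (F k x) x.

(* The unknowns are the coordinates of the N + 1 values of x (true) and of
   y (false), packed in one row vector. *)
Let I : finType := (bool * ('I_N.+1 * 'I_n))%type.
Let part (b : bool) (z : 'rV[R]_#|I|) (k : 'I_N.+1) : 'rV[R]_n :=
  \row_j z 0 (enum_rank (b, (k, j))).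
Let eqn (b : bool) (z : 'rV[R]_#|I|) (k : 'I_N.+1) : 'rV[R]_n :=
  if b then h *: F k (part true z k) - (part false z (ordS k) - part false z k)
  else h *: psi (part false z k) - (part true z k - part true z (ord_pred k)).
Let G (z : 'rV[R]_#|I|) : 'rV[R]_#|I| :=
  \row_l let i := enum_val l in eqn i.1 z i.2.1 0 i.2.2.

Let part_cont b k : continuous (fun z => part b z k).
Proof.
move=> z; apply: (@cvg_rV _ _ _ (nbhs z) (nbhs_filter z)) => j.
rewrite (_ : (fun t => _) = (fun t : 'rV[R]_#|I| => t 0 (enum_rank (b, (k, j))))).
  by rewrite mxE; apply: (@coord_continuous R 1 #|I|).
by apply/funext => t; rewrite mxE.
Qed.

Let eqn_cont b k : continuous (fun z => eqn b z k).
Proof.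
move=> z; rewrite /eqn; case: b.
  have Fc : F k (part true t k) @[t --> z] --> F k (part true z k).
    by apply: (@cvg_comp _ _ _ (fun z => part true z k) (F k) _ _ _ (@part_cont true k z));
       exact: F_cont.
  exact: (cvgB (cvgZ (cvg_cst h) Fc) (cvgB (@part_cont false (ordS k) z) (@part_cont false k z))).
have psic : psi (part false t k) @[t --> z] --> psi (part false z k).
  by apply: (@cvg_comp _ _ _ (fun z => part false z k) psi _ _ _ (@part_cont false k z));
     exact: psi_cont.
exact: (cvgB (cvgZ (cvg_cst h) psic) (cvgB (@part_cont true k z) (@part_cont true (ord_pred k) z))).
Qed.

Let dotp_G z : dotp (G z) z =
  \sum_k (dotp (eqn true z k) (part true z k) + dotp (eqn false z k) (part false z k)).
Proof.
rewrite /dotp (reindex (@enum_rank I)) /=; last by apply: onW_bij; apply: enum_rank_bij.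
rewrite (eq_bigr (fun i : I => eqn i.1 z i.2.1 0 i.2.2 * part i.1 z i.2.1 0 i.2.2)).
  rewrite -(pair_bigA _ (fun b (kj : 'I_N.+1 * 'I_n) =>
    eqn b z kj.1 0 kj.2 * part b z kj.1 0 kj.2)) /= big_bool /=.
  rewrite -(pair_bigA _ (fun k j => eqn true z k 0 j * part true z k 0 j)) /=.
  rewrite -(pair_bigA _ (fun k j => eqn false z k 0 j * part false z k 0 j)) /=.
  by rewrite -big_split.
by move=> [b [k j]] _; rewrite !mxE enum_rankK.
Qed.

Let norm_le_parts z : `|z| <= \sum_k (`|part true z k| + `|part false z k|).
Proof.
apply: norm_rV_le => [|l]; first by apply: sumr_ge0 => k _; rewrite addr_ge0.
have [[b [k j]] ->] : exists i : I, l = enum_rank i.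
  by exists (enum_val l); rewrite enum_valK.
rewrite (bigD1 k) //=.
have := norm_coord_le (part b z k) j; rewrite mxE => /le_trans; apply.
apply: (@le_trans _ _ (`|part true z k| + `|part false z k|)).
  by case: b; rewrite ?lerDl ?lerDr.
by rewrite lerDl; apply: sumr_ge0 => ? _; rewrite addr_ge0.
Qed.

(** Here X k stands for the value of x at the end of the k-th step and Y k for
    the value of y at its beginning; with this shift the cross terms of the
    pairing of the equations with (X, Y) cancel exactly under summation. *)
Lemma discrete_system : exists X Y : 'I_N.+1 -> 'rV[R]_n, forall k,
  X k - X (ord_pred k) = h *: psi (Y k) /\ Y (ordS k) - Y k = h *: F k (X k).
Proof.
have [||z Hz|z Gz] := @zero_of_outward R #|I| (`|C| *+ (N.+1).*2 + 1) G.
- by rewrite ltr_pwDr // mulrn_wge0.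
- move=> z; apply: (@cvg_rV _ _ _ (nbhs z) (nbhs_filter z)) => l; rewrite (_ : (fun t => _) = (fun t =>
      eqn (enum_val l).1 t (enum_val l).2.1 0 (enum_val l).2.2)).
    rewrite mxE.
    by apply: cvg_coord; apply: eqn_cont.
  by apply/funext => t; rewrite mxE.
- rewrite dotp_G.
  have cancel_cross : \sum_k (dotp (part false z (ordS k) - part false z k) (part true z k)
      + dotp (part true z k - part true z (ord_pred k)) (part false z k)) = 0.
    under eq_bigr do rewrite !dotpBl (dotpC (part true z _) (part false z _)) addrA subrK.
    rewrite sumrB [X in _ - X](reindex_inj (@ordS_inj _)) /=.
    under [X in _ - X]eq_bigr do rewrite ordSK dotpC.
    by rewrite subrr.
  rewrite -[X in 0 <= X]addr0 -[X in _ + X]cancel_cross -big_split /=.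
  apply: (@le_trans _ _ (h * \sum_k ((`|part true z k| - C) + (`|part false z k| - C)))).
    apply: mulr_ge0; first exact: ltW.
    have : \sum_(k < N.+1) (C + C) <= `|C| *+ (N.+1).*2.
      rewrite sumr_const card_ord -mulr2n -mulrnA mul2n lerMn2r ler_norm orbT //.
    have := norm_le_parts z.
    under [X in _ -> _ -> 0 <= X]eq_bigr do rewrite addrACA -opprD.
    rewrite sumrB; lra.
  rewrite mulr_sumr; apply: ler_sum => k _.
  have := F_coercive k (part true z k); have := psi_coercive (part false z k).
  rewrite /eqn !dotpBl !dotpZl => h1 h2.
  have := ler_wpM2l (ltW h_gt0) h1; have := ler_wpM2l (ltW h_gt0) h2; lra.
exists (part true z), (part false z) => k.
have e b : eqn b z k = 0.
  apply/rowP => j; move/rowP/(_ (enum_rank (b, (k, j)))): Gz.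
  by rewrite !mxE enum_rankK.
by split; apply/esym/eqP; rewrite -subr_eq0; apply/eqP; [exact: (e false)|exact: (e true)].
Qed.

Lemma discrete_solution : exists x y : nat -> 'rV[R]_n,
  [/\ x N.+1 = x 0%N, y N.+1 = y 0%N &
  forall k, (k < N.+1)%N -> x k.+1 - x k = h *: psi (y k) /\
    y k.+1 - y k = h *: F k (x k.+1)].
Proof.
have [X [Y XY]] := discrete_system.
exists (fun k => if k is k'.+1 then X (inord k') else X ord_max).
exists (fun k => Y (inord (k %% N.+1))); split.
- by congr X; apply: val_inj; rewrite /= inordK.
- by rewrite modnn mod0n.
move=> k kN; have [e1 e2] := XY (inord k).
rewrite (modn_small kN); split.
  rewrite -e1; congr (_ - _); case: k kN {e1 e2} => [|k] kN.
    by congr X; apply: val_inj; rewrite /= inordK //= modn_small.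
  congr X; apply: val_inj; rewrite /= !inordK //; last exact: ltnW.
  by rewrite addSn /= modnDr modn_small // ltnW.
have -> : inord (k.+1 %% N.+1) = ordS (inord k) :> 'I_N.+1.
  by apply: val_inj; rewrite /= !inordK // ltn_pmod.
by rewrite e2 inordK.
Qed.

End DiscreteProblem.

Section APrioriBounds.
Variables (R : realType) (n : nat).
Implicit Types x y : nat -> 'rV[R]_n.

Lemma drift_le x N (a : nat -> R) : (forall k, (k < N)%N -> `|x k.+1 - x k| <= a k) ->
  forall i, (i <= N)%N -> `|x i - x 0%N| <= \sum_(k < N) a k.
Proof.
move=> xa i iN.
have a0 k : (k < N)%N -> 0 <= a k by move=> kN; apply: le_trans (xa k kN).
apply: (@le_trans _ _ (\sum_(k < i) a k)).
  elim: i iN => [_|i IH iN]; first by rewrite subrr normr0 big_ord0.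
  rewrite big_ord_recr /= -(subrK (x i) (x i.+1)) -addrA addrC.
  by rewrite (le_trans (ler_normD _ _)) // lerD ?xa // IH // ltnW.
rewrite -(subnKC iN) big_split_ord /= lerDl; apply: sumr_ge0 => k _.
by apply: a0; rewrite /= -ltn_subRL.
Qed.

Lemma ex_below_average N (b : nat -> R) (h K : R) : (0 < N)%N -> 0 < h ->
  \sum_(k < N) h * b k <= K -> exists2 k, (k < N)%N & b k <= K / (h * N%:R).
Proof.
move=> N0 h0 bK; apply: contrapT => hn.
have hN : 0 < h * N%:R by rewrite mulr_gt0 ?ltr0n.
have : \sum_(k < N) h * (K / (h * N%:R)) < \sum_(k < N) h * b k.
  apply: ltr_sum; first by apply/hasP; exists (Ordinal N0); rewrite ?mem_index_enum.
  move=> k _; rewrite ltr_pM2l // ltNge; apply/negP => bk.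
  by apply: hn; exists k.
have -> : \sum_(k < N) h * (K / (h * N%:R)) = K.
  by rewrite sumr_const card_ord -[LHS]mulr_natr mulrAC [LHS]mulrC divfK // gt_eqF.
lra.
Qed.

Variables (T C B : R) (psi : 'rV[R]_n -> 'rV[R]_n).
Hypotheses (T_gt0 : 0 < T) (C_ge0 : 0 <= C) (B_ge0 : 0 <= B).
Hypothesis psi_coercive : forall v, `|v| - C <= dotp (psi v) v.
Hypothesis psi_bounded : forall r, exists P, forall v, `|v| <= r -> `|psi v| <= P.

(** Summing <x, y> over a period gives 0, hence a bound on the mesh-weighted
    sums of the norms of x and y by coercivity.  The sum for x bounds the
    oscillation of y, and the sum for y shows that y is small somewhere; so y
    is bounded.  Then psi(y), hence the increments of x, and finally x and
    the increments of y, are bounded. *)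
Lemma discrete_apriori_bound : exists2 K, 0 <= K &
  forall (N : nat) (h : R) (F : nat -> 'rV[R]_n -> 'rV[R]_n) x y,
  (0 < N)%N -> 0 < h -> h * N%:R = T ->
  (forall k u, `|u| - C <= dotp (F k u) u) ->
  (forall k u, `|F k u| <= B + `|u|) ->
  x N = x 0%N -> y N = y 0%N ->
  (forall k, (k < N)%N -> x k.+1 - x k = h *: psi (y k) /\
    y k.+1 - y k = h *: F k (x k.+1)) ->
  forall k, (k <= N)%N -> [/\ `|x k| <= K, `|y k| <= K &
    (k < N)%N -> `|x k.+1 - x k| <= h * K /\ `|y k.+1 - y k| <= h * K].
Proof.
pose K1 : R := 2 * C * T.
pose Ky : R := K1 / T + 2 * (B * T + K1).
have [P psiP] := psi_bounded Ky.
pose P' : R := `|P|.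
pose Kx : R := K1 / T + 2 * (P' * T).
have K1_0 : 0 <= K1 by rewrite !mulr_ge0 // ltW.
have K1T : 0 <= K1 / T by rewrite divr_ge0 // ltW.
have BT0 : 0 <= B * T by rewrite mulr_ge0 // ltW.
have PT0 : 0 <= P' * T by rewrite mulr_ge0 ?normr_ge0 // ltW.
have P0 : 0 <= P' by apply: normr_ge0.
have Kx0 : 0 <= Kx by apply: addr_ge0 => //; apply: mulr_ge0.
have Ky0 : 0 <= Ky by apply: addr_ge0 => //; apply: mulr_ge0 => //; apply: addr_ge0.
exists (Kx + Ky + P' + B); first by rewrite (addr_ge0 (addr_ge0 (addr_ge0 Kx0 Ky0) P0)).
move=> N h F x y N0 h0 hN Fc FB xN yN step.
have energy : \sum_(k < N) h * (`|y k| + `|x k.+1|) <= K1.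
  have tele : \sum_(k < N) h * (dotp (psi (y k)) (y k) + dotp (F k (x k.+1)) (x k.+1)) = 0.
    rewrite (eq_bigr (fun k : 'I_N => dotp (x k.+1) (y k.+1) - dotp (x k) (y k))).
      by rewrite -(big_mkord xpredT (fun k => dotp (x k.+1) (y k.+1) - dotp (x k) (y k)))
        telescope_sumr // xN yN subrr.
    move=> k _; have [e1 e2] := step k (ltn_ord k).
    rewrite mulrDr -!dotpZl -e1 -e2 !dotpBl (dotpC (y k.+1)) (dotpC (y k)); ring.
  have : \sum_(k < N) h * ((`|y k| - C) + (`|x k.+1| - C)) <= 0.
    rewrite -[leRHS]tele; apply: ler_sum => k _.
    by rewrite ler_pM2l // lerD.
  under eq_bigr do rewrite addrACA mulrDr.
  rewrite big_split /= [X in _ + X]sumr_const card_ord -mulr_natr.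
  have -> : h * (- C - C) * N%:R = - K1 by rewrite /K1 -hN; ring.
  lra.
have sumx : \sum_(k < N) h * `|x k.+1| <= K1.
  apply: le_trans energy; apply: ler_sum => k _.
  by rewrite ler_pM2l // lerDr.
have sumy : \sum_(k < N) h * `|y k| <= K1.
  apply: le_trans energy; apply: ler_sum => k _.
  by rewrite ler_pM2l // lerDl.
have bounded_of (z : nat -> 'rV[R]_n) D i : (i <= N)%N -> `|z i| <= K1 / T ->
    (forall j, (j <= N)%N -> `|z j - z 0%N| <= D) ->
    forall j, (j <= N)%N -> `|z j| <= K1 / T + 2 * D.
  move=> iN zi zD j jN; have := zD i iN; have := zD j jN.
  have := ler_normD (z j - z 0%N) (z 0%N - z i + z i).
  have := ler_normD (z 0%N - z i) (z i).
  rewrite (distrC (z 0%N) (z i)) !subrK; lra.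
have yK k : (k <= N)%N -> `|y k| <= Ky.
  have [i iN yi] := @ex_below_average N (fun k => `|y k|) h K1 N0 h0 sumy; rewrite hN in yi.
  apply: (bounded_of y _ i (ltnW iN) yi) => j jN.
  apply: le_trans (@drift_le y N (fun k => h * (B + `|x k.+1|)) _ j jN) _.
    by move=> l lN; rewrite (step l lN).2 normrZ gtr0_norm // ler_pM2l.
  under eq_bigr do rewrite mulrDr.
  rewrite big_split /= sumr_const card_ord -mulr_natr.
  by rewrite -hN; lra.
have psiP' k : (k <= N)%N -> `|psi (y k)| <= P'.
  by move=> kN; apply: le_trans (psiP _ (yK k kN)) (ler_norm _).
have xK k : (k <= N)%N -> `|x k| <= Kx.
  have [i iN xi] := @ex_below_average N (fun k => `|x k.+1|) h K1 N0 h0 sumx; rewrite hN in xi.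
  apply: (bounded_of x _ i.+1 iN xi) => j jN.
  apply: le_trans (@drift_le x N (fun=> h * P') _ j jN) _.
    by move=> l lN; rewrite (step l lN).1 normrZ gtr0_norm // ler_pM2l // psiP' // ltnW.
  by rewrite sumr_const card_ord -mulr_natr -hN; lra.
have B0 : 0 <= B by [].
clearbody Kx Ky P' => k kN; split.
- by apply: le_trans (xK k kN) _; lra.
- by apply: le_trans (yK k kN) _; lra.
move=> {}kN; have [-> ->] := step k kN; rewrite !normrZ gtr0_norm // !ler_pM2l //; split.
  by apply: le_trans (psiP' k (ltnW kN)) _; lra.
by apply: le_trans (FB k (x k.+1)) _; have := xK _ kN; lra.
Qed.

End APrioriBounds.

(** * Letting the mesh tend to zero *)

Section EulerLimit.
Variables (R : realType) (n : nat) (T : R).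
Hypothesis T_gt0 : 0 < T.

Definition mesh (N : nat) : R := T / N.+1%:R.
Definition node (N : nat) (t : R) : nat := Num.truncn (t / mesh N).

Lemma mesh_gt0 N : 0 < mesh N.
Proof. by rewrite divr_gt0 // ltr0n. Qed.

Lemma mesh_mul N : mesh N * N.+1%:R = T.
Proof. by rewrite divfK // pnatr_eq0. Qed.

Lemma mesh_small (e : R) : 0 < e -> \forall N \near \oo, mesh N < e.
Proof.
move=> e0; have d0 : 0 < e / T by rewrite divr_gt0.
have [K _ hK] := near_infty_natSinv_lt (PosNum d0).
by exists K => // N KN; have := hK N KN; rewrite /= ltr_pdivlMr // mulrC.
Qed.

Lemma node_itv N t : t \in `[0, T] ->
  (node N t)%:R * mesh N <= t < (node N t)%:R * mesh N + mesh N.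
Proof.
rewrite in_itv /= => /andP[t0 tT]; have m0 := mesh_gt0 N.
have q0 : 0 <= t / mesh N by rewrite divr_ge0 // ltW.
have /andP[h1 h2] := truncn_itv q0.
by rewrite -ler_pdivlMr // h1 /= -[X in _ + X]mul1r -mulrDl -ltr_pdivrMr // natr1.
Qed.

Lemma node_le N t : t \in `[0, T] -> (node N t <= N.+1)%N.
Proof.
move=> tT; have /andP[h1 _] := node_itv N tT; move: tT; rewrite in_itv /= => /andP[_ tT].
rewrite -(ler_nat R) -(ler_pM2r (mesh_gt0 N)) [leRHS]mulrC mesh_mul.
exact: le_trans h1 tT.
Qed.

Lemma node0 N : node N 0 = 0%N.
Proof. by rewrite /node mul0r truncn0. Qed.

Lemma nodeT N : node N T = N.+1.
Proof.
by rewrite /node /mesh invf_div mulrCA divff ?gt_eqF // mulr1 natrK.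
Qed.

Lemma increments_near (z : nat -> 'rV[R]_n) (h e : R) (v : 'rV[R]_n) (i j : nat) :
  (i <= j)%N ->
  (forall k, (i <= k < j)%N -> `|z k.+1 - z k - h *: v| <= h * e) ->
  `|z j - z i - ((j%:R - i%:R) * h) *: v| <= (j%:R - i%:R) * h * e.
Proof.
move=> /subnKC <-; elim: (j - i)%N => [|d IH] H.
  by rewrite addn0 !subrr !mul0r scale0r subr0 normr0.
have {}IH : `|z (i + d)%N - z i - (((i + d)%:R - i%:R) * h) *: v| <=
    ((i + d)%:R - i%:R) * h * e by apply: IH => k kd; apply: H; lia.
have := H (i + d)%N; rewrite leq_addr addnS ltnSn => /(_ isT) {}H.
rewrite [X in `|X|](_ : _ = (z (i + d).+1 - z (i + d)%N - h *: v) +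
   (z (i + d)%N - z i - (((i + d)%:R - i%:R) * h) *: v)).
  apply: le_trans (ler_normD _ _) _; apply: le_trans (lerD H IH) _.
  by rewrite -natr1 le_eqVlt; apply/orP; left; apply/eqP; ring.
apply/rowP => l; rewrite !mxE -natr1; ring.
Qed.

Variables (U : set_system nat) (K : R).
Context {UF : UltraFilter U}.
Hypothesis UU : \oo `<=` U.

Lemma cvg_dist_le (u : nat -> 'rV[R]_n) (l v : 'rV[R]_n) (e : R) :
  u N @[N --> U] --> l -> (\forall N \near U, `|u N - v| <= e) -> `|l - v| <= e.
Proof.
move=> /cvgrPdist_le ul uv; apply/ler_addgt0Pr => a a0.
have [N [h1 h2]] := filter_ex (filterI (ul a a0) uv).
have := ler_normD (l - u N) (u N - v); rewrite addrA subrK => /le_trans; apply.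
by rewrite addrC lerD.
Qed.

Section OneSequence.
Variable z : nat -> nat -> 'rV[R]_n.
Hypothesis z_bounded : forall N k, (k <= N.+1)%N -> `|z N k| <= K.
Hypothesis z_lip : forall N k, (k < N.+1)%N -> `|z N k.+1 - z N k| <= mesh N * K.

(** An ultrafilter on the set of meshes gives a pointwise limit of all the
    piecewise constant interpolations at once, without extracting
    subsequences. *)
Lemma ex_limit : exists zl : R -> 'rV[R]_n,
  forall t, t \in `[0, T] -> z N (node N t) @[N --> U] --> zl t.
Proof.
have /choice[zl hz] : forall t : R, exists v : 'rV[R]_n, t \in `[0, T] -> z N (node N t) @[N --> U] --> v.
  move=> t; have [tT|tT] := boolP (t \in `[0, T]); last by exists 0.
  have := @compact_norm_ball R n K; rewrite compact_ultra.
  have FU : UltraFilter (z N (node N t) @[N --> U]).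
    split; first exact: fmap_proper_filter.
    move=> G PG sG; apply/seteqP; split => // A GA.
    have [//|UA] := in_ultra_setVsetC ((fun N => z N (node N t)) @^-1` A) UF.
    have GcA : G (~` A) by apply: sG.
    by have [x [? ?]] := filter_ex (filterI GA GcA).
  case/(_ _ FU) => [|v [_ hv]]; last by exists v.
  suff : U [set N | `|z N (node N t)| <= K] by [].
  by apply: filterS filterT => N _; apply: z_bounded; apply: node_le.
by exists zl.
Qed.

Variable zl : R -> 'rV[R]_n.
Hypothesis z_lim : forall t, t \in `[0, T] -> z N (node N t) @[N --> U] --> zl t.

(** By the common Lipschitz bound, all nodes close to t, and not only the one
    used to define the limit at t, carry values close to the limit. *)
Lemma nodes_near_limit t e : t \in `[0, T] -> 0 < e -> exists2 d, 0 < d &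
  \forall N \near U, forall k, (k <= N.+1)%N -> `|k%:R * mesh N - t| < d ->
    `|z N k - zl t| <= e.
Proof.
move=> tT e0.
have K0 : 0 <= K by apply: le_trans (z_bounded (leq0n 1)).
have d0 : 0 < e / (3 * (K + 1)) by rewrite divr_gt0 // mulr_gt0 // ltr_wpDl.
set d := e / _ in d0.
have dE : e = d * (3 * (K + 1)) by rewrite /d divfK // gt_eqF // mulr_gt0 // ltr_wpDl.
exists d => //.
have e3 : 0 < e / 3 by rewrite divr_gt0.
have h1 : U [set N | mesh N < d] by apply: UU; apply: mesh_small.
have /cvgrPdist_le/(_ _ e3) h2 := z_lim tT.
apply: filterS2 h1 h2 => N /= hN zN k kN kt.
have /andP[n1 n2] := node_itv N tT; have nN := node_le N tT.
have step i j : (i <= j)%N -> (j <= N.+1)%N ->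
    `|z N j - z N i| <= (j%:R - i%:R) * mesh N * K.
  move=> ij jN.
  rewrite -[z N j - z N i]subr0 -(scaler0 _ ((j%:R - i%:R) * mesh N)).
  apply: increments_near => // l /andP[_ lj]; rewrite scaler0 subr0.
  by apply: z_lip; exact: leq_trans lj jN.
have hk : `|z N k - z N (node N t)| <= 2 * d * K.
  have m0 := mesh_gt0 N.
  move: kt; rewrite ltr_norml => /andP[kt1 kt2].
  case: (leqP k (node N t)) => kn.
    rewrite distrC; apply: le_trans (step _ _ kn nN) _.
    by rewrite ler_wpM2r // mulrBl; lra.
  apply: le_trans (step _ _ (ltnW kn) kN) _.
  by rewrite ler_wpM2r // mulrBl; lra.
have := ler_normD (z N k - z N (node N t)) (z N (node N t) - zl t).
rewrite addrA subrK => /le_trans; apply.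
move: zN; rewrite distrC => zN; apply: le_trans (lerD hk zN) _; nra.
Qed.

Lemma limit_continuous : {within `[0, T], continuous zl}.
Proof.
apply/subspace_continuousP => t /= tT.
apply/cvgrPdist_le => e e0.
have [d d0 hd] := nodes_near_limit tT e0.
have d2 : 0 < d / 2 by rewrite divr_gt0.
rewrite near_withinE; near=> s => /= sT; rewrite distrC.
apply: (cvg_dist_le (z_lim sT)).
have h1 : U [set N | mesh N < d / 2] by apply: UU; apply: mesh_small.
apply: filterS2 h1 hd => N /= hN; apply; first exact: node_le.
have /andP[n1 n2] := node_itv N sT.
have : `|t - s| < d / 2 by near: s; apply: (@cvgr_dist_lt _ _ _ (nbhs t) _ id).
by rewrite !ltr_norml; lra.
Unshelve. all: by end_near.
Qed.

Variables (r : nat -> nat -> 'rV[R]_n) (rho : R -> 'rV[R]_n).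
Hypothesis z_step : forall N k, (k < N.+1)%N -> z N k.+1 - z N k = mesh N *: r N k.
Hypothesis r_near : forall t e, t \in `[0, T] -> 0 < e -> exists2 d, 0 < d &
  \forall N \near U, forall k, (k < N.+1)%N -> `|k%:R * mesh N - t| < d ->
    `|r N k - rho t| <= e.

(** If the slopes used near t are close to rho t, then so are all difference
    quotients between nodes near t, up to an error of the order of the mesh,
    which disappears in the limit.  No integral equation is needed. *)
Lemma limit_derivative : derivative_on T zl rho.
Proof.
move=> t tT; apply/cvgrPdist_le => e e0.
have [d d0 hd] := r_near tT e0.
have d2 : 0 < d / 2 by rewrite divr_gt0.
rewrite near_withinE; near=> s => /= -[sT /eqP st].
have ts : `|t - s| < d / 2 by near: s; apply: (@cvgr_dist_lt _ _ _ (nbhs t) _ id).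
have st0 : s - t != 0 by rewrite subr_eq0.
suff H : `|zl s - zl t - (s - t) *: rho t| <= `|s - t| * e.
  have -> : rho t - (s - t)^-1 *: (zl s - zl t) =
      - ((s - t)^-1 *: (zl s - zl t - (s - t) *: rho t)).
    by rewrite [in RHS]scalerBr scalerA mulVf // scale1r opprB.
  by rewrite normrN normrZ normfV ler_pdivrMl ?normr_gt0.
apply/ler_addgt0Pr => eta eta0.
have Rpos : 0 < 4 * (`|rho t| + e + 1).
  by rewrite mulr_gt0 // addr_gt0 // ltr_wpDl // ltW.
have h1 : U [set N | mesh N < d / 2] by apply: UU; apply: mesh_small.
have h2 : U [set N | mesh N < eta / (4 * (`|rho t| + e + 1))].
  by apply: UU; apply: mesh_small; rewrite divr_gt0.
have lim : z N (node N s) - z N (node N t) @[N --> U] --> zl s - zl t.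
  exact: (cvgB (z_lim sT) (z_lim tT)).
apply: (cvg_dist_le lim).
apply: filterS2 (filterI h1 h2) hd => N /= [m1 m2] hr.
have m0 := mesh_gt0 N.
have {}m2 : mesh N * (4 * (`|rho t| + e + 1)) < eta by rewrite -ltr_pdivlMr.
have /andP[a1 a2] := node_itv N sT; have /andP[b1 b2] := node_itv N tT.
have sN := node_le N sT; have tN := node_le N tT.
have stn : `|z N (node N s) - z N (node N t) -
     (((node N s)%:R - (node N t)%:R) * mesh N) *: rho t| <=
     `|((node N s)%:R - (node N t)%:R) * mesh N| * e.
  have inc i j k : (i <= k < j)%N -> (j <= N.+1)%N -> 
      `|i%:R * mesh N - t| < d -> `|j%:R * mesh N - t| < d ->
      `|z N k.+1 - z N k - mesh N *: rho t| <= mesh N * e.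
    move=> /andP[ik kj] jN id jd.
    have kN : (k < N.+1)%N by exact: leq_trans kj jN.
    rewrite z_step // -scalerBr normrZ gtr0_norm // ler_pM2l //; apply: hr => //.
    have : i%:R * mesh N <= k%:R * mesh N by rewrite ler_pM2r // ler_nat.
    have : k%:R * mesh N <= j%:R * mesh N by rewrite ler_pM2r // ler_nat ltnW.
    by move: id jd; rewrite !ltr_norml; lra.
  have sd : `|(node N s)%:R * mesh N - t| < d.
    by move: ts; rewrite !ltr_norml; lra.
  have td : `|(node N t)%:R * mesh N - t| < d by rewrite ltr_norml; lra.
  case: (leqP (node N t) (node N s)) => nts.
    rewrite [X in _ <= X * _]ger0_norm; last by rewrite mulr_ge0 ?subr_ge0 ?ler_nat // ltW.
    apply: increments_near => // k kk; exact: (inc _ _ _ kk).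
  rewrite [X in _ <= X * _]ler0_norm; last first.
    by rewrite mulr_le0_ge0 ?subr_le0 ?ler_nat ?(ltnW nts) ?(ltW m0).
  rewrite -normrN [X in `|X|](_ : _ = z N (node N t) - z N (node N s) -
     (((node N t)%:R - (node N s)%:R) * mesh N) *: rho t); last first.
    by apply/rowP => l; rewrite !mxE; ring.
  rewrite -mulNr opprB; apply: increments_near (ltnW nts) _ => k kk.
  exact: (inc _ _ _ kk).
set q : R := ((node N s)%:R - (node N t)%:R) * mesh N in stn *.
have qs : `|q - (s - t)| <= 2 * mesh N by rewrite /q mulrBl ler_norml; lra.
rewrite [X in `|X|](_ : _ = (z N (node N s) - z N (node N t) - q *: rho t)
    + (q - (s - t)) *: rho t); last by apply/rowP => l; rewrite !mxE; ring.
apply: le_trans (ler_normD _ _) _; rewrite normrZ.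
have q2 : `|q| <= `|s - t| + 2 * mesh N.
  by have := ler_normD (q - (s - t)) (s - t); rewrite subrK; lra.
have := ler_wpM2r (ltW e0) q2; have := ler_wpM2r (normr_ge0 (rho t)) qs.
lra.
Unshelve. all: by end_near.
Qed.

End OneSequence.
End EulerLimit.

Section PeriodicSystem.
Variables (R : realType) (n : nat).

Lemma continuous_bounded_on_balls (psi : 'rV[R]_n -> 'rV[R]_n) (r : R) :
  continuous psi -> exists P : R, forall v, `|v| <= r -> `|psi v| <= P.
Proof.
move=> psic.
have [P [_ HP]] : bounded_set (psi @` [set v : 'rV[R]_n | `|v| <= r]).
  apply: compact_bounded; apply: continuous_compact; last exact: compact_norm_ball.
  exact: continuous_subspaceT.
exists (P + 1) => v vr; apply: (HP (P + 1)); last by exists v.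
by rewrite ltrDl.
Qed.

(** The slopes of the scheme are close to the expected derivatives because
    they are continuous functions of values that are themselves close to the
    limit at nearby nodes. *)
Lemma periodic_system (T C B : R) (psi : 'rV[R]_n -> 'rV[R]_n)
    (F : R -> 'rV[R]_n -> 'rV[R]_n) :
  0 < T -> 0 <= C -> 0 <= B -> continuous psi ->
  continuous (fun p : R * 'rV[R]_n => F p.1 p.2) ->
  (forall v, `|v| - C <= dotp (psi v) v) ->
  (forall t v, `|v| - C <= dotp (F t v) v) ->
  (forall t v, `|F t v| <= B + `|v|) ->
  exists x y : R -> 'rV[R]_n,
    [/\ derivative_on T x (psi \o y) /\ derivative_on T y (fun t => F t (x t)),
        {within `[0, T], continuous x}, {within `[0, T], continuous y},
        x 0 = x T & y 0 = y T].
Proof.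
move=> T0 C0 B0 psic Fc psiC FC FB.
have [K K0 HK] := discrete_apriori_bound T0 C0 B0 psiC
  (fun r => continuous_bounded_on_balls r psic).
pose Fd N (k : nat) := F (k.+1%:R * mesh T N).
have Fdc N k : continuous (Fd N k).
  move=> v.
  have pc : ((k.+1%:R * mesh T N : R), w) @[w --> v] --> ((k.+1%:R * mesh T N : R), v).
    exact: (@cvg_pair _ _ _ _ _ _ (nbhs_filter v) _ _ (fun=> _) id
      (@cvg_cst _ _ _ _ (nbhs_filter v)) cvg_id).
  exact: (@cvg_comp _ _ _ _ (fun p : R * 'rV[R]_n => F p.1 p.2) _ _ _ pc (Fc _)).
have /choice[xy hxy] : forall N : nat, exists xy : (nat -> 'rV[R]_n) * (nat -> 'rV[R]_n),
  [/\ xy.1 N.+1 = xy.1 0%N, xy.2 N.+1 = xy.2 0%N &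
  forall k, (k < N.+1)%N -> xy.1 k.+1 - xy.1 k = mesh T N *: psi (xy.2 k) /\
    xy.2 k.+1 - xy.2 k = mesh T N *: Fd N k (xy.1 k.+1)].
  move=> N; have [x [y h]] := discrete_solution N (mesh_gt0 T0 N) psic (Fdc N)
    psiC (fun k => FC _).
  by exists (x, y).
pose x N := (xy N).1; pose y N := (xy N).2.
have bnd N k : (k <= N.+1)%N -> [/\ `|x N k| <= K, `|y N k| <= K &
    (k < N.+1)%N -> `|x N k.+1 - x N k| <= mesh T N * K /\
                   `|y N k.+1 - y N k| <= mesh T N * K].
  have [e1 e2 e3] := hxy N.
  exact: (HK N.+1 (mesh T N) (Fd N) _ _ _ (mesh_gt0 T0 N) (mesh_mul T N)
    (fun k => FC _) (fun k => FB _) e1 e2 e3).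
have [U [UF UU]] := @ultraFilterLemma nat \oo _.
have xb N k : (k <= N.+1)%N -> `|x N k| <= K by move=> /bnd[].
have yb N k : (k <= N.+1)%N -> `|y N k| <= K by move=> /bnd[].
have xl N k : (k < N.+1)%N -> `|x N k.+1 - x N k| <= mesh T N * K.
  by move=> kN; have [_ _ /(_ kN)[]] := bnd N k (ltnW kN).
have yl N k : (k < N.+1)%N -> `|y N k.+1 - y N k| <= mesh T N * K.
  by move=> kN; have [_ _ /(_ kN)[]] := bnd N k (ltnW kN).
have [X hX] := ex_limit T0 xb; have [Y hY] := ex_limit T0 yb.
have xnear := nodes_near_limit T0 UU xb xl hX.
have ynear := nodes_near_limit T0 UU yb yl hY.
have T_in : T \in `[0, T] by rewrite in_itv /= lexx ltW.
have o_in : 0 \in `[0, T] by rewrite in_itv /= lexx ltW.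
exists X, Y; split.
- split.
    apply: (limit_derivative T0 UU hX (r := fun N k => psi (y N k))).
      by move=> N k kN; have [_ _ /(_ k kN)[]] := hxy N.
    move=> t e tT e0.
    have /cvgrPdist_le/(_ e e0)/nbhs_ballP[a /= a0 ha] := psic (Y t).
    have [d d0 hd] := ynear UF t (a / 2) tT (divr_gt0 a0 (ltr0n _ 2)).
    exists d => //; apply: filterS hd => N hN k kN kt.
    rewrite distrC; apply: ha; rewrite -ball_normE /= distrC.
    by apply: le_lt_trans (hN k (ltnW kN) kt) _; lra.
  apply: (limit_derivative T0 UU hY (r := fun N k => Fd N k (x N k.+1))).
    by move=> N k kN; have [_ _ /(_ k kN)[]] := hxy N.
  move=> t e tT e0.
  have /cvgrPdist_le/(_ e e0)/nbhs_ballP[a /= a0 ha] := Fc (t, X t).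
  have a2 : 0 < a / 2 by rewrite divr_gt0.
  have [d d0 hd] := xnear UF t (a / 2) tT a2.
  pose d' := Num.min d a / 2.
  have d'0 : 0 < d' by rewrite divr_gt0 // lt_min d0 a0.
  have d'd : d' * 2 <= d by rewrite /d' divfK // ge_min lexx.
  have d'a : d' * 2 <= a by rewrite /d' divfK // ge_min lexx orbT.
  exists d' => //.
  have h1 : U [set N | mesh T N < d'] by apply: UU; apply: mesh_small.
  apply: filterS2 h1 hd => N /= m1 hN k kN kt.
  have m0 := mesh_gt0 T0 N.
  have kt' : `|k.+1%:R * mesh T N - t| < d' * 2.
    move: kt; rewrite -natr1 mulrDl mul1r !ltr_norml; lra.
  rewrite distrC; apply: (ha (k.+1%:R * mesh T N, x N k.+1)); split => /=.
    by rewrite -ball_normE /= distrC; lra.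
  rewrite -ball_normE /= distrC.
  apply: le_lt_trans (hN k.+1 kN _) _; last by lra.
  by lra.
- exact: (limit_continuous T0 UU xb xl hX).
- exact: (limit_continuous T0 UU yb yl hY).
- have e : (fun N => x N (node T N 0)) = (fun N => x N (node T N T)).
    by apply/funext => N; rewrite node0 nodeT //; have [] := hxy N.
  by move: (hX _ o_in); rewrite e => h0; exact: (cvg_unique _ h0 (hX _ T_in)).
- have e : (fun N => y N (node T N 0)) = (fun N => y N (node T N T)).
    by apply/funext => N; rewrite node0 nodeT //; have [] := hxy N.
  by move: (hY _ o_in); rewrite e => h0; exact: (cvg_unique _ h0 (hY _ T_in)).
Qed.
End PeriodicSystem.

(** * Derivatives along parabolas *)

Section Calculus.
Variables (R : realType) (n : nat).
Implicit Types (p u w : 'rV[R]_n).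

Lemma is_derive_comp_diff (W : normedModType R) (V : 'rV[R]_n -> W) (g : R -> 'rV[R]_n)
    (t : R) (dg : 'rV[R]_n) :
  is_derive t 1 g dg -> differentiable V (g t) ->
  is_derive t 1 (V \o g) ('d V (g t) dg).
Proof.
move=> [gt gE] Vg.
have dg_t : differentiable g t by apply/derivable1_diffP.
have dVg : differentiable (V \o g) t by apply: differentiable_comp.
apply: DeriveDef; first exact/derivable1_diffP.
by rewrite deriveE // diff_comp //= -gE deriveE.
Qed.

Lemma is_derive_parabola p w (nu : 'rV[R]_n) (t : R) :
  is_derive t 1 (fun s : R => p + s *: w + s ^+ 2 *: nu) (w + (2 * t) *: nu).
Proof.
have H : (fun h : R => h^-1 *: (((fun s : R => p + s *: w + s ^+ 2 *: nu) \o shift t) (h *: (1 : R))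
    - (p + t *: w + t ^+ 2 *: nu))) @ 0^' --> w + (2 * t) *: nu.
  have lim : (fun h : R => w + (2 * t + h) *: nu) @ 0^' --> w + (2 * t) *: nu.
    apply: cvg_within_filter.
    have a0 : 2 * t + h @[h --> (0 : R)] --> 2 * t.
      by rewrite -[X in _ --> X]addr0; exact: (cvgD (cvg_cst _) cvg_id).
    exact: (cvgD (cvg_cst w) (cvgZ a0 (cvg_cst nu))).
  apply: cvg_trans lim; apply: near_eq_cvg.
  near=> h; have h0 : h != 0 by near: h; exact: nbhs_dnbhs_neq.
  rewrite /= /shift /GRing.scale /= mulr1.
  apply/rowP => j; rewrite !mxE.
  have -> : h^-1 * (p 0 j + (h + t) * w 0 j + (h + t) ^+ 2 * nu 0 j -
     (p 0 j + t * w 0 j + t ^+ 2 * nu 0 j)) =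
     (h^-1 * h) * (w 0 j + (2 * t + h) * nu 0 j) by ring.
  by rewrite mulVf // mul1r.
apply: DeriveDef; first exact: (cvgP _ H).
exact: (cvg_lim _ H).
Unshelve. all: by end_near.
Qed.

Lemma diff_gradient (V : 'rV[R]_n -> R) u w : differentiable V u ->
  'd V u w = dotp (gradient V u) w.
Proof.
move=> Vu; rewrite {1}(row_sum_delta w) linear_sum /dotp; apply: eq_bigr => i _.
by rewrite linearZ /= mxE deriveE // mulrC.
Qed.

Lemma diff_hessian (V : 'rV[R]_n -> R) u w :
  'd (gradient V) u w = w *m hessian V u.
Proof. by rewrite /hessian /jacobian mul_rV_lin1. Qed.

Variable V : 'rV[R]_n -> R.
Hypothesis V_C2 : class_C2 V.

Let V_diff u : differentiable V u.
Proof. by case: V_C2. Qed.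

Let dV_diff u : differentiable (gradient V) u.
Proof. by case: V_C2. Qed.

Lemma gradient_continuous : continuous (gradient V).
Proof. by move=> u; apply: differentiable_continuous. Qed.

Lemma V_continuous : continuous V.
Proof. by move=> u; apply: differentiable_continuous. Qed.

Lemma is_derive_along_parabola p w nu (t : R) :
  is_derive t 1 (fun s : R => V (p + s *: w + s ^+ 2 *: nu))
    (dotp (gradient V (p + t *: w + t ^+ 2 *: nu)) (w + (2 * t) *: nu)).
Proof.
rewrite -diff_gradient //.
exact: (is_derive_comp_diff (is_derive_parabola p w nu t) (V_diff _)).
Qed.

Lemma is_derive_dotp (f g : R -> 'rV[R]_n) (df dg : 'rV[R]_n) (t : R) :
  is_derive t 1 f df -> is_derive t 1 g dg ->
  is_derive t 1 (fun s => dotp (f s) (g s)) (dotp df (g t) + dotp (f t) dg).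
Proof.
move=> [fd fE] [gd gE].
have diff_f : differentiable f t by apply/derivable1_diffP; exact: fd.
have cf := differentiable_continuous diff_f.
have H : (fun h : R => h^-1 *: (((fun s => dotp (f s) (g s)) \o shift t) (h *: (1 : R))
    - dotp (f t) (g t))) @ 0^' --> dotp df (g t) + dotp (f t) dg.
  have fl : (fun h => h^-1 *: ((f \o shift t) (h *: (1 : R)) - f t)) @ 0^' --> df.
    by rewrite -fE; apply: fd.
  have gl : (fun h => h^-1 *: ((g \o shift t) (h *: (1 : R)) - g t)) @ 0^' --> dg.
    by rewrite -gE; apply: gd.
  have fs : f (h + t) @[h --> 0^'] --> f t.
    apply: cvg_within_filter.
    have sh : (h + t) @[h --> (0 : R)] --> t.
      by rewrite -[X in _ --> X]add0r; exact: (cvgD cvg_id (cvg_cst t)).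
    exact: (@cvg_comp _ _ _ (fun h => h + t) f _ _ _ sh cf).
  have lim : (fun h : R => dotp (h^-1 *: ((f \o shift t) (h *: (1 : R)) - f t)) (g t)
      + dotp (f (h + t)) (h^-1 *: ((g \o shift t) (h *: (1 : R)) - g t))) @ 0^'
      --> dotp df (g t) + dotp (f t) dg.
    exact: (cvgD (cvg_dotp fl (cvg_cst (g t))) (cvg_dotp fs gl)).
  apply: cvg_trans lim; apply: near_eq_cvg; near=> h.
  rewrite /= /shift /GRing.scale /= mulr1 -/(GRing.scale _ _) !dotpE.
  by rewrite !mulrBr; ring.
apply: DeriveDef; first exact: (cvgP _ H).
exact: (cvg_lim _ H).
Unshelve. all: by end_near.
Qed.

(** Along the parabola V would have a local maximum at t = 0; its first
    derivative there vanishes, so w is tangent to the level set, and its second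
    derivative is the Hessian term in w, which is nonnegative, plus
    2 <V'(p), nu>, which is positive. *)
Lemma no_inner_parabola p w nu (d : R) : 
  (forall y, dotp (gradient V p) y = 0 -> 0 <= dotp (y *m hessian V p) y) ->
  V p = 0 -> 0 < dotp (gradient V p) nu -> 0 < d ->
  ~ (forall t, `|t| < d -> V (p + t *: w + t ^+ 2 *: nu) <= 0).
Proof.
move=> Hconv Vp pnu d0 inner.
pose g (s : R) := V (p + s *: w + s ^+ 2 *: nu).
pose k (t : R) := dotp (gradient V (p + t *: w + t ^+ 2 *: nu)) (w + (2 * t) *: nu).
have gk (t : R) : is_derive t 1 g (k t) by apply: is_derive_along_parabola.
have p0 : p + 0 *: w + 0 ^+ 2 *: nu = p.
  by rewrite expr0n /= !scale0r !addr0.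
have k0 : k 0 = dotp (gradient V p) w.
  by rewrite /k p0 mulr0 scale0r addr0.
have tangent : dotp (gradient V p) w = 0.
  rewrite -k0; have [_ <-] := gk 0.
  suff : is_derive (0 : R) 1 g 0 by case.
  apply: (@derive1_at_max R g (- d) d).
  - lra.
  - by move=> t _; case: (gk t).
  - by rewrite in_itv /=; lra.
  move=> t; rewrite in_itv /= => td.
  have -> : g 0 = 0 by rewrite /g p0.
  by apply: inner; rewrite ltr_norml.
have dk : is_derive (0 : R) 1 k (dotp (w *m hessian V p) w + 2 * dotp (gradient V p) nu).
  have h1 : is_derive (0 : R) 1 (fun t : R => gradient V (p + t *: w + t ^+ 2 *: nu))
      (w *m hessian V p).
    have := is_derive_comp_diff (is_derive_parabola p w nu 0) (dV_diff _).
    by rewrite p0 mulr0 scale0r addr0 diff_hessian.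
  have h2 : is_derive (0 : R) 1 (fun t : R => w + (2 * t) *: nu) (2 *: nu).
    have := is_derive_parabola w (2 *: nu) 0 0.
    rewrite scaler0 addr0; congr is_derive.
    by apply/funext => s; rewrite scaler0 addr0 scalerA mulrC.
  have := is_derive_dotp h1 h2.
  by rewrite p0 mulr0 scale0r addr0 dotpZr.
set c := _ + _ in dk.
have c0 : 0 < c by rewrite ltr_wpDl ?mulr_gt0 // Hconv.
have [dkd dkE] := dk.
have lim : (fun h : R => h^-1 * (k h)) @ 0^' --> c.
  rewrite -dkE; have := dkd; rewrite /derivable /derive.
  rewrite (_ : (fun h => _) = (fun h : R => h^-1 * k h)) //.
  apply/funext => h; rewrite /= /shift /GRing.scale /= mulr1 addr0.
  by rewrite k0 tangent subr0.
have [e /= e0 he] : exists2 e : R, 0 < e & forall h, 0 < h -> h < e -> 0 < k h.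
  have : \forall h \near 0^', 0 < h^-1 * k h by apply: (cvgr_gt _ lim).
  rewrite near_withinE => /nbhs_ballP[e /= e0 he]; exists e => // h h0 hhe.
  have := he h; rewrite -ball_normE /= sub0r normrN gtr0_norm // => /(_ hhe).
  by rewrite gt_eqF // => /(_ isT); rewrite pmulr_rgt0 // invr_gt0.
pose s := Num.min d e / 2.
have s0 : 0 < s by rewrite divr_gt0 // lt_min d0.
have sd : s < d by rewrite /s ltr_pdivrMr // (@le_lt_trans _ _ d) ?ge_min ?lexx //; lra.
have se : s < e by rewrite /s ltr_pdivrMr // (@le_lt_trans _ _ e) ?ge_min ?lexx ?orbT //; lra.
have [|z zs] := @MVT R g k 0 s s0 (fun x _ => gk x).
  apply: derivable_within_continuous => x _; by case: (gk x).
have -> : g 0 = 0 by rewrite /g p0.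
rewrite subr0 subr0 => gs.
have : g s <= 0 by apply: inner; rewrite gtr0_norm.
rewrite gs leNgt => /negP; apply; rewrite mulr_gt0 //.
by move: zs; rewrite in_itv /= => /andP[z0 zs]; apply: he => //; apply: lt_trans se.
Qed.
End Calculus.

(** * Convexity of a component of the sublevel set *)

(** The contact set is compact, so a contact with largest first coordinate
    exists. *)
Lemma first_contact (R : realType) (g : R * R -> R) (a b c d : R) :
  continuous g -> (exists x y, [/\ a <= x <= b, c <= y <= d & 0 <= g (x, y)]) ->
  exists x, [/\ a <= x <= b, exists2 y, c <= y <= d & 0 <= g (x, y) &
    forall x' y, x < x' <= b -> c <= y <= d -> g (x', y) < 0].
Proof.
move=> gc [x0 [y0 [xab ycd gxy]]].
pose A := (`[a, b] `*` `[c, d]) `&` (g @^-1` [set r | 0 <= r]).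
have cA : compact A.
  apply: (@subclosed_compact _ _ (`[a, b] `*` `[c, d])).
  - apply: closedI.
      rewrite (_ : _ `*` _ = (fst @^-1` `[a, b]) `&` (snd @^-1` `[c, d])) //.
      apply: closedI; (apply: closed_comp; last exact: interval_closed) => p _.
        exact: cvg_fst.
      exact: cvg_snd.
    by apply: closed_comp => [p _|]; [exact: gc|exact: closed_ge].
  - by apply: compact_setX; exact: segment_compact.
  - by move=> p [].
have A0 : A !=set0 by exists (x0, y0); split => //=; split; rewrite /= in_itv.
have [|[x y]] := @compact_EVT_max _ R fst A A0 cA.
  by apply: continuous_subspaceT => p; exact: cvg_fst.
rewrite inE => -[[/= xI yI] gp] hmax.
exists x; split.
- by move: xI; rewrite in_itv.
- by exists y => //; move: yI; rewrite in_itv.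
move=> x' y' /andP[xx' x'b] y'cd; rewrite ltNge; apply/negP => g0.
have : (x', y') \in A.
  rewrite inE; split => //=; split; rewrite /= in_itv //= x'b andbT.
  by move: xI; rewrite in_itv /= => /andP[ax _]; apply: le_trans ax (ltW xx').
by move=> /hmax /=; rewrite leNgt xx'.
Qed.

Lemma convex_combination_lt (R : realType) (l A B r : R) :
  0 <= l -> l <= 1 -> A < r -> B < r -> (1 - l) * A + l * B < r.
Proof.
move=> l0 l1 Ar Br; pose M := Num.max A B.
have hA : (1 - l) * A <= (1 - l) * M by rewrite ler_wpM2l ?subr_ge0 // le_max lexx.
have hB : l * B <= l * M by rewrite ler_wpM2l // le_max lexx orbT.
have : M < r by rewrite gt_max Ar.
lra.
Qed.

Section Convexity.
Variables (R : realType) (n : nat) (V : 'rV[R]_n -> R).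
Hypothesis V_C2 : class_C2 V.
Hypothesis V_regular : forall u, V u = 0 -> gradient V u != 0.
Hypothesis V_tangent : forall u y, V u = 0 ->
  dotp (gradient V u) y = 0 -> 0 <= dotp (y *m hessian V u) y.
Implicit Types (a b c p q u w : 'rV[R]_n).

Definition segment_inside a b := forall t : R, 0 <= t <= 1 -> V (a + t *: (b - a)) < 0.

Lemma increasing_along q w (s : R) : 0 < s ->
  (forall t, 0 <= t <= s -> 0 < dotp (gradient V (q + t *: w)) w) ->
  V q < V (q + s *: w).
Proof.
move=> s0 pos.
have H (t : R) : is_derive t 1 (fun t : R => V (q + t *: w))
    (dotp (gradient V (q + t *: w)) w).
  have := is_derive_along_parabola V_C2 q w 0 t.
  rewrite !scaler0 !addr0; congr is_derive.
  by apply/funext => r; rewrite scaler0 addr0.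
have [|z] := @MVT R _ _ 0 s s0 (fun x _ => H x).
  by apply: derivable_within_continuous => x _; case: (H x).
rewrite in_itv /= => /andP[z0 zs]; rewrite scale0r addr0 subr0 => e.
by rewrite -subr_gt0 e mulr_gt0 // pos // !ltW.
Qed.

Lemma norm_segment_lt p q w (r s t : R) : `|q - p| < r -> `|q + s *: w - p| < r ->
  0 <= t <= s -> `|q + t *: w - p| < r.
Proof.
move=> h1 h2 /andP[t0 ts].
have [s0|s0] := leP s 0.
  by have -> : t = 0; [lra|rewrite scale0r addr0].
have l0 : 0 <= t / s by rewrite divr_ge0 // ltW.
have l1 : t / s <= 1 by rewrite ler_pdivrMr // mul1r.
have tE : t = t / s * s by rewrite divfK // gt_eqF.
rewrite {}tE; set l := t / s in l0 l1 *; clearbody l.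
have -> : q + (l * s) *: w - p = (1 - l) *: (q - p) + l *: (q + s *: w - p).
  by apply/rowP => j; rewrite !mxE; ring.
apply: le_lt_trans (ler_normD _ _) _; rewrite !normrZ.
rewrite (ger0_norm l0) [`|1 - l|]ger0_norm ?subr_ge0 //.
exact: convex_combination_lt.
Qed.

Lemma transversal_ball p : V p = 0 -> exists2 r : R, 0 < r &
  forall q, `|q - p| < r -> 0 < dotp (gradient V q) (gradient V p).
Proof.
move=> Vp.
have : \forall q \near p, 0 < dotp (gradient V q) (gradient V p).
  have lim : dotp (gradient V q) (gradient V p) @[q --> p] -->
      dotp (gradient V p) (gradient V p).
    exact: (cvg_dotp (@gradient_continuous _ _ _ V_C2 p) (cvg_cst _)).
  by apply: (cvgr_gt _ lim); rewrite dotp_gt0 V_regular.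
move=> /nbhs_ballP[r /= r0 hr]; exists r => // q qp.
by apply: hr; rewrite -ball_normE /= distrC.
Qed.

Let continuous_affine2 p w (v : 'rV[R]_n) (f g : R * R -> R) : continuous f -> continuous g ->
  continuous (fun z => V (p + f z *: w + g z *: v)).
Proof.
move=> fc gc z.
have h : p + f z' *: w + g z' *: v @[z' --> z] --> p + f z *: w + g z *: v.
  exact: (cvgD (cvgD (cvg_cst p) (cvgZ (fc z) (cvg_cst w))) (cvgZ (gc z) (cvg_cst v))).
apply: (@cvg_comp _ _ _ (fun z => p + f z *: w + g z *: v) V _ _ _ h).
exact: V_continuous.
Qed.

Let continuous_line p w : continuous (fun s : R => V (p + s *: w)).
Proof.
move=> s.
have h : p + t *: w @[t --> s] --> p + s *: w.
  exact: (cvgD (cvg_cst p) (cvgZ cvg_id (cvg_cst w))).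
apply: (@cvg_comp _ _ _ (fun t => p + t *: w) V _ _ _ h).
exact: V_continuous.
Qed.

(** Suppose that the segment meets the zero set of V, and let p be the last
    contact point.  Before p the segment is in D, after p strictly inside.  In
    a small parallelogram around p with sides along the segment and along
    nu = V'(p), where V increases in the direction nu, take a convex parabola
    that starts on the segment before p, ends slightly above it after p, and
    passes strictly above p.  Lowering it until it lies in D produces a point
    where it touches the zero set from inside, against no_inner_parabola. *)
Lemma segment_inside_of_le0 a b :
  (forall t : R, 0 <= t <= 1 -> V (a + t *: (b - a)) <= 0) ->
  V a < 0 -> V b < 0 -> segment_inside a b.
Proof.
move=> seg Va Vb t t01; rewrite lt_neqAle seg // andbT; apply/eqP => Vt.
set w := b - a in seg Vt *.
have fst_c : continuous (@fst R R) by move=> ?; exact: cvg_fst.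
have snd_c : continuous (@snd R R) by move=> ?; exact: cvg_snd.
have cst_c (k : R) : continuous (fun _ : R * R => k) by move=> ?; exact: cvg_cst.
have [|t0 [t001 [y1 _ Vt0] after]] :=
    @first_contact R (fun z => V (a + z.1 *: w + (0 : R) *: w)) 0 1 0 0
      (continuous_affine2 fst_c (@cst_c 0)) _.
  by exists t, 0; rewrite lexx /= scale0r addr0 Vt.
rewrite /= scale0r addr0 in Vt0.
have {}after s : t0 < s <= 1 -> V (a + s *: w) < 0.
  by move=> s1; have := after s 0 s1; rewrite /= scale0r addr0 lexx; apply.
have Vp : V (a + t0 *: w) = 0 by apply/eqP; rewrite eq_le seg // Vt0.
move: t001 => /andP[t00 t01'].
have t0_gt0 : 0 < t0.
  by rewrite lt_neqAle t00 andbT; apply/eqP => e; move: Vp; rewrite -e scale0r addr0; lra.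
have t0_lt1 : t0 < 1.
  rewrite lt_neqAle t01' andbT; apply/eqP => e; move: Vp; rewrite e scale1r /w.
  by rewrite addrC subrK; lra.
pose p := a + t0 *: w; pose nu := gradient V p.
have [r r0 hr] := transversal_ball Vp.
have nu0 : 0 < `|nu| by rewrite normr_gt0; apply: V_regular.
have w0 : 0 <= `|w| by [].
have den0 : 0 < 2 * (`|w| + 1) by rewrite mulr_gt0 // ltr_wpDl.
pose al : R := Num.min (Num.min t0 (1 - t0)) (r / 2 / (2 * (`|w| + 1))).
have al0 : 0 < al by rewrite !lt_min t0_gt0 subr_gt0 t0_lt1 !divr_gt0.
have al_t0 : al <= t0 by rewrite !ge_min lexx.
have al_t1 : al <= 1 - t0 by rewrite !ge_min lexx orbT.
have al_w : al * `|w| < r / 2.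
  have : al * (2 * (`|w| + 1)) <= r / 2 by rewrite -ler_pdivlMr // !ge_min lexx !orbT.
  nra.
have Vp_al : V (p + al *: w) < 0.
  by rewrite /p -addrA -scalerDl after //; lra.
have [de [de0 de_nu Vde]] : exists de : R, [/\ 0 < de, 2 * de * `|nu| < r / 2 &
    V (p + al *: w + de *: nu) < 0].
  have lim : (fun s : R => V (p + al *: w + s *: nu)) @ 0 --> V (p + al *: w + 0 *: nu).
    exact: continuous_line.
  have : \forall s \near (0 : R), V (p + al *: w + s *: nu) < 0.
    by apply: (cvgr_lt _ lim); rewrite scale0r addr0.
  move=> /nbhs_ballP[e /= e0 he].
  have d2 : 0 < 2 * `|nu| by rewrite mulr_gt0.
  pose de : R := Num.min e (r / 2 / (2 * `|nu|)) / 2.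
  have de0 : 0 < de by rewrite divr_gt0 // lt_min e0 !divr_gt0.
  have de_e : de * 2 <= e by rewrite /de divfK // ge_min lexx.
  have de_r : de * 2 <= r / 2 / (2 * `|nu|) by rewrite /de divfK // ge_min lexx orbT.
  exists de; split => //.
    by move: de_r; rewrite ler_pdivlMr //; nra.
  by apply: he; rewrite -ball_normE /= sub0r normrN gtr0_norm //; lra.
have inball t1 s1 : `|t1| <= al -> `|s1| <= 2 * de -> 
    `|p + t1 *: w + s1 *: nu - p| < r.
  move=> t1al s1de; have -> : p + t1 *: w + s1 *: nu - p = t1 *: w + s1 *: nu.
    by rewrite -[X in X - p]addrA addrAC subrr add0r.
  apply: le_lt_trans (ler_normD _ _) _; rewrite !normrZ.
  have := ler_wpM2r w0 t1al; have := ler_wpM2r (ltW nu0) s1de; lra.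
have mono t1 s1 s2 : `|t1| <= al -> `|s1| <= 2 * de -> `|s2| <= 2 * de -> s1 < s2 ->
    V (p + t1 *: w + s1 *: nu) < V (p + t1 *: w + s2 *: nu).
  move=> h1 h2 h3 s12.
  have -> : p + t1 *: w + s2 *: nu = p + t1 *: w + s1 *: nu + (s2 - s1) *: nu.
    by rewrite -[RHS]addrA -scalerDl addrCA subrr addr0.
  apply: increasing_along; first by rewrite subr_gt0.
  move=> v vs; apply: hr; apply: norm_segment_lt vs; first exact: inball.
  by rewrite -[X in X - p]addrA -scalerDl addrCA subrr addr0; exact: inball.
pose ka : R := de / (4 * al ^+ 2).
have ka0 : 0 < ka by rewrite divr_gt0 // mulr_gt0 // exprn_gt0.
have kaE : de = ka * (4 * al ^+ 2) by rewrite /ka divfK // gt_eqF // mulr_gt0 // exprn_gt0.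
(* The parabola has heights 0 and de over the ends - al and al, and a
   positive height over the contact point. *)
pose q (v : R) := ka * (v + al) ^+ 2.
have q_itv v : - al <= v <= al -> 0 <= q v <= de.
  move=> v_al; rewrite /q kaE; apply/andP; split.
    by rewrite mulr_ge0 ?sqr_ge0 // ltW.
  by rewrite ler_pM2l //; nra.
pose g (z : R * R) := V (p + z.2 *: w + (q z.2 - z.1) *: nu).
have gc : continuous g.
  apply: continuous_affine2 => // z.
  have z2c := @snd_c z.
  apply: cvgB; last exact: cvg_fst.
  apply: (cvgM (cvg_cst ka)).
  exact: (cvgM (cvgD z2c (cvg_cst al)) (cvgD z2c (cvg_cst al))).
have q0 : q 0 = ka * al ^+ 2 by rewrite /q add0r.
have al2 : 0 < ka * al ^+ 2 by rewrite mulr_gt0 // exprn_gt0.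
have pE : p + 0 *: w + 0 *: nu = p by rewrite !scale0r !addr0.
have n0 : `|0 : R| <= al by rewrite normr0 ltW.
have n0' : `|0 : R| <= 2 * de by rewrite normr0 mulr_ge0 // ltW.
(* Here c is the amount by which the parabola has been lowered; c is the
   largest amount for which it still meets the set where V is nonnegative. *)
have [|c [/andP[c_lo c_hi] [v v_al gcv] above]] :=
    @first_contact R g (ka * al ^+ 2 / 2) (2 * de) (- al) al gc.
  exists (ka * al ^+ 2 / 2), 0; split.
  - by rewrite lexx /= kaE; lra.
  - by lra.
  have : V (p + 0 *: w + 0 *: nu) < V (p + 0 *: w + (q 0 - ka * al ^+ 2 / 2) *: nu).
    apply: mono => //; last by rewrite q0; lra.
    by rewrite q0 kaE ger0_norm; lra.
  by rewrite pE (Vp : V p = 0) => /ltW.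
have c0 : 0 < c by apply: lt_le_trans c_lo; rewrite divr_gt0.
have v_al' : `|v| <= al by rewrite ler_norml.
have /andP[qv0 qv1] := q_itv v v_al.
have seg' v1 : - al <= v1 <= al -> V (p + v1 *: w + 0 *: nu) <= 0.
  move=> v1al; rewrite scale0r addr0 /p -addrA -scalerDl; apply: seg; lra.
have c_lt : c < 2 * de.
  rewrite lt_neqAle c_hi andbT; apply/eqP => ce.
  have := seg' v v_al; rewrite leNgt => /negP; apply.
  apply: le_lt_trans gcv _; rewrite /g /=; apply: mono => //; last by lra.
  by rewrite ler_norml; lra.
have below v1 : - al <= v1 <= al -> g (c, v1) <= 0.
  move=> v1al; rewrite leNgt; apply/negP => gpos.
  have lim : (fun s : R => g (s, v1)) @ c --> g (c, v1).
    have h : (s, v1) @[s --> c] --> (c, v1).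
      exact: (cvg_pair cvg_id (cvg_cst _)).
    exact: (@cvg_comp _ _ _ _ g _ _ _ h (gc _)).
  have : \forall s \near c, 0 < g (s, v1) by apply: (cvgr_gt _ lim).
  move=> /nbhs_ballP[e /= e0 he].
  pose s : R := Num.min (c + e / 2) (2 * de).
  have cs : c < s by rewrite lt_min c_lt andbT ltrDl divr_gt0.
  have sde : s <= 2 * de by rewrite ge_min lexx orbT.
  have se : s <= c + e / 2 by rewrite ge_min lexx.
  have : 0 < g (s, v1).
    by apply: he; rewrite -ball_normE /= distrC gtr0_norm ?subr_gt0 //; lra.
  by rewrite ltNge => /negP; apply; apply: ltW; apply: above => //; rewrite cs.
(* The contact is not at an end of the parabola, because the ends of the
   lowered parabola are strictly inside. *)
have v_lo : - al < v.
  rewrite lt_neqAle; case/andP: (v_al) => -> _; rewrite andbT; apply/eqP => ve.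
  have := seg' v v_al; rewrite leNgt => /negP; apply.
  apply: le_lt_trans gcv _; rewrite /g /= /q -ve addNr expr0n /= mulr0 sub0r.
  apply: mono => //; [|by rewrite ler_norml; lra|by lra].
  by rewrite normrN gtr0_norm.
have v_hi : v < al.
  rewrite lt_neqAle; case/andP: (v_al) => _ ->; rewrite andbT; apply/eqP => ve.
  have qe : q v = de by rewrite /q ve kaE; ring.
  move: Vde; rewrite ltNge => /negP; apply.
  apply: le_trans gcv _; rewrite /g /= qe ve ltW //.
  apply: mono => //; [|by rewrite ler_norml; lra|by rewrite ler_norml; lra|by lra].
  by rewrite gtr0_norm.
pose p' := p + v *: w + (q v - c) *: nu.
have Vp' : V p' = 0 by apply/eqP; rewrite eq_le (below v v_al) gcv.
pose d : R := Num.min (al - v) (v + al).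
have d0 : 0 < d by rewrite lt_min subr_gt0 v_hi /= addrC -ltrBlDl sub0r.
have d1 : d <= al - v by rewrite ge_min lexx.
have d2 : d <= v + al by rewrite ge_min lexx orbT.
apply: (@no_inner_parabola R n V V_C2 p' (w + (2 * ka * (v + al)) *: nu) (ka *: nu) d) => //.
- by move=> y; apply: V_tangent.
- rewrite dotpZr mulr_gt0 // hr // /p' inball //.
  by rewrite ler_norml; lra.
move=> s sd; have := below (v + s); rewrite /g /=.
have -> : p' + s *: (w + (2 * ka * (v + al)) *: nu) + s ^+ 2 *: (ka *: nu) =
    p + (v + s) *: w + (q (v + s) - c) *: nu.
  by rewrite /p' /q; apply/rowP => j; rewrite !mxE; ring.
by apply; move: sd; rewrite ltr_norml; lra.
Qed.
Lemma segment_inside_sym a b : segment_inside a b -> segment_inside b a.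
Proof.
move=> h t t01; have := h (1 - t); rewrite (_ : a + _ = b + t *: (a - b)).
  by apply; lra.
by apply/rowP => j; rewrite !mxE; ring.
Qed.

Lemma segment_inside_l a b : segment_inside a b -> V a < 0.
Proof. by move=> /(_ 0); rewrite scale0r addr0; apply; rewrite lexx ler01. Qed.

Lemma segment_inside_sub a b (s : R) : 0 <= s <= 1 -> segment_inside a b ->
  segment_inside a (a + s *: (b - a)).
Proof.
move=> /andP[s0 s1] h t /andP[t0 t1].
rewrite addrAC subrr add0r scalerA; apply: h.
by rewrite mulr_ge0 //= mulr_ile1.
Qed.

(** Slide the endpoint of the segment from b to c.  At the first position, if
    any, where the segment from a meets the zero set, it still lies in D with
    endpoints strictly inside, which segment_inside_of_le0 forbids. *)
Lemma segment_inside_trans a b c :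
  segment_inside a b -> segment_inside b c -> segment_inside a c.
Proof.
move=> ab bc.
pose g (z : R * R) := V (a + z.2 *: (b - a) + (z.2 * (1 - z.1)) *: (c - b)).
have gE x y : g (x, y) = V (a + y *: (b + (1 - x) *: (c - b) - a)).
  by rewrite /g /=; congr V; apply/rowP => j; rewrite !mxE; ring.
have gc : continuous g.
  apply: continuous_affine2 => z; first exact: cvg_snd.
  have z1 : z'.1 @[z' --> z] --> z.1 by exact: cvg_fst.
  have z2 : z'.2 @[z' --> z] --> z.2 by exact: cvg_snd.
  exact: (cvgM z2 (cvgB (cvg_cst (1 : R)) z1)).
suff all_neg x y : 0 <= x <= 1 -> 0 <= y <= 1 -> g (x, y) < 0.
  move=> t t01; have := all_neg 0 t; rewrite gE subr0 scale1r (addrC b) subrK.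
  by apply => //; rewrite lexx ler01.
move=> x01 y01; rewrite ltNge; apply/negP => gxy.
have [|x0 [x001 [y0 y001 g0] after]] := @first_contact R g 0 1 0 1 gc.
  by exists x, y.
have /andP[x0_ge x0_le] := x001.
have x0_lt : x0 < 1.
  rewrite lt_neqAle x0_le andbT; apply/eqP => e.
  by have := ab y0 y001; move: g0; rewrite gE e subrr scale0r addr0 leNgt => /negP.
suff : segment_inside a (b + (1 - x0) *: (c - b)).
  by move=> /(_ y0 y001); rewrite -gE ltNge g0.
apply: segment_inside_of_le0 => [t t01||].
- rewrite -gE leNgt; apply/negP => gpos.
  have lim : (fun s : R => g (s, t)) @ x0 --> g (x0, t).
    have h : (s, t) @[s --> x0] --> (x0, t) by exact: (cvg_pair cvg_id (cvg_cst _)).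
    exact: (@cvg_comp _ _ _ _ g _ _ _ h (gc _)).
  have : \forall s \near x0, 0 < g (s, t) by apply: (cvgr_gt _ lim).
  move=> /nbhs_ballP[e /= e0 he].
  pose s : R := Num.min (x0 + e / 2) 1.
  have xs : x0 < s by rewrite lt_min x0_lt andbT ltrDl divr_gt0.
  have s1 : s <= 1 by rewrite ge_min lexx orbT.
  have se : s <= x0 + e / 2 by rewrite ge_min lexx.
  have : 0 < g (s, t).
    by apply: he; rewrite -ball_normE /= distrC gtr0_norm ?subr_gt0 //; lra.
  by rewrite ltNge => /negP; apply; apply: ltW; apply: after => //; rewrite xs.
- exact: segment_inside_l ab.
- by apply: bc; lra.
Qed.

Lemma increasing_in_ball p (r : R) q w (s : R) : 0 < s -> `|q - p| < r ->
  `|q + s *: w - p| < r ->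
  (forall q', `|q' - p| < r -> 0 < dotp (gradient V q') w) -> V q < V (q + s *: w).
Proof.
move=> s0 h1 h2 h; apply: increasing_along => // t ts; apply: h.
exact: norm_segment_lt ts.
Qed.

Lemma segment_inside_ball p (r : R) q q' : (forall z, `|z - p| < r -> V z < 0) ->
  `|q - p| < r -> `|q' - p| < r -> segment_inside q q'.
Proof.
move=> h h1 h2 t t01; apply: h; apply: (norm_segment_lt (s := 1)) => //.
by rewrite scale1r addrCA subrr addr0.
Qed.

Definition convex_set (K : set 'rV[R]_n) :=
  forall x y (t : R), K x -> K y -> 0 <= t <= 1 -> K (x + t *: (y - x)).

Lemma closure_ballE (S : set 'rV[R]_n) u :
  closure S u <-> forall e : R, 0 < e -> exists2 s, S s & `|s - u| < e.
Proof.
split=> [cu e e0|h B /nbhs_ballP[e /= e0 he]].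
  have [s [Ss]] := cu _ (nbhsx_ballx u e e0).
  by rewrite -ball_normE /= distrC => su; exists s.
have [s Ss su] := h e e0; exists s; split => //.
by apply: he; rewrite -ball_normE /= distrC.
Qed.

Lemma convex_closure (S : set 'rV[R]_n) : convex_set S -> convex_set (closure S).
Proof.
move=> cS x y t /closure_ballE hx /closure_ballE hy /andP[t0 t1].
apply/closure_ballE => e e0.
have [x' Sx x'x] := hx e e0; have [y' Sy y'y] := hy e e0.
exists (x' + t *: (y' - x')); first by apply: cS => //; rewrite t0.
have -> : x' + t *: (y' - x') - (x + t *: (y - x)) = (1 - t) *: (x' - x) + t *: (y' - y).
  by apply/rowP => j; rewrite !mxE; ring.
apply: le_lt_trans (ler_normD _ _) _; rewrite !normrZ.
rewrite (ger0_norm t0) [`|1 - t|]ger0_norm ?subr_ge0 //.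
exact: convex_combination_lt.
Qed.

Lemma exists_inside : [set x | V x <= 0] !=set0 -> exists a, V a < 0.
Proof.
move=> [u /= Vu]; have [Vu0|] := ltrP (V u) 0; first by exists u.
move=> Vu0; have {Vu0}Vu : V u = 0 by apply/eqP; rewrite eq_le Vu.
have [r r0 hr] := transversal_ball Vu.
have g0 : 0 < `|gradient V u| by rewrite normr_gt0 V_regular.
pose s : R := r / 2 / `|gradient V u|.
have s0 : 0 < s by rewrite !divr_gt0.
have sg : s * `|gradient V u| = r / 2 by rewrite divfK // gt_eqF.
exists (u - s *: gradient V u).
rewrite -Vu -[X in _ < V X](subrK (s *: gradient V u)).
apply: (@increasing_in_ball u r) => //.
  by rewrite addrAC subrr add0r normrN normrZ gtr0_norm // sg; lra.
by rewrite subrK subrr normr0.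
Qed.

Definition outward_normal (K : set 'rV[R]_n) u (nu : 'rV[R]_n) :=
  forall k, K k -> dotp nu (k - u) <= 0.

(** K is the closure of the set S of points seen from a inside the open set
    V < 0; transitivity makes S convex, and closed under segments inside that
    open set.  At a point of K where V < 0 a whole ball lies in K, so no
    nonzero normal exists.  At a boundary point u, every direction w with
    <V'(u), w> < 0 leads into K, so a normal is nonpositive on that open half
    space, which forces it to be a positive multiple of V'(u). *)
Lemma convex_component : [set x | V x <= 0] !=set0 ->
  exists K : set 'rV[R]_n, [/\ K !=set0, closed K, K `<=` [set x | V x <= 0],
    convex_set K & forall u nu, K u -> nu != 0 -> outward_normal K u nu ->
      V u = 0 /\ exists2 c : R, 0 < c & nu = c *: gradient V u].
Proof.
move=> /exists_inside[a Va].
pose S := [set b | segment_inside a b].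
have Saa : S a by move=> t _; rewrite subrr scaler0 addr0.
have SV s : S s -> V s < 0 by move=> /segment_inside_sym /segment_inside_l.
have S_ext s q : S s -> segment_inside s q -> S q by exact: segment_inside_trans.
exists (closure S); split.
- by exists a; apply: subset_closure.
- exact: closed_closure.
- rewrite [X in _ `<=` X](_ : _ = closure [set x | V x <= 0]).
    by apply: closure_subset => s /SV /ltW.
  apply/closure_id; apply: (@closed_comp _ _ V [set r | r <= 0]).
    by move=> x _; exact: V_continuous.
  exact: closed_le.
- apply: convex_closure => x y t Sx Sy t01.
  apply: (S_ext x) => //; apply: segment_inside_sub => //.
  by apply: segment_inside_trans Sy; apply: segment_inside_sym.
move=> u nu /closure_ballE Ku nu0 normal.
have nupos : 0 < dotp nu nu by rewrite dotp_gt0.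
have Vu : V u = 0.
  have [Vu|Vu|//] := ltrgtP (V u) 0.
    have lim : V q @[q --> u] --> V u by exact: V_continuous.
    have : \forall q \near u, V q < 0 by apply: (cvgr_lt _ lim).
    move=> /nbhs_ballP[r /= r0 hr].
    have {}hr z : `|z - u| < r -> V z < 0.
      by move=> zu; apply: hr; rewrite -ball_normE /= distrC.
    have nunorm : 0 < `|nu| by rewrite normr_gt0.
    pose s : R := r / 2 / `|nu|.
    have s0 : 0 < s by rewrite !divr_gt0.
    have sg : s * `|nu| = r / 2 by rewrite divfK // gt_eqF.
    have [b Sb bu] := Ku r r0.
    have Sq : S (u + s *: nu).
      apply: (S_ext b) => //; apply: (segment_inside_ball hr) => //.
      by rewrite addrAC subrr add0r normrZ gtr0_norm // sg; lra.
    have := normal _ (subset_closure Sq); rewrite addrAC subrr add0r dotpZr.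
    by rewrite pmulr_rle0 // leNgt nupos.
  have lim : V q @[q --> u] --> V u by exact: V_continuous.
  have : \forall q \near u, 0 < V q by apply: (cvgr_gt _ lim).
  move=> /nbhs_ballP[r /= r0 hr]; have [b /SV Vb bu] := Ku r r0.
  have : 0 < V b by apply: hr; rewrite -ball_normE /= distrC.
  by lra.
split=> //.
pose gr := gradient V u.
have gr_pos : 0 < dotp gr gr by rewrite dotp_gt0 V_regular.
have inward w : dotp gr w < 0 -> dotp nu w <= 0.
  move=> grw.
  have lim : dotp (gradient V q) w @[q --> u] --> dotp (gradient V u) w.
    exact: (cvg_dotp (@gradient_continuous _ _ _ V_C2 u) (cvg_cst _)).
  have : \forall q \near u, dotp (gradient V q) w < 0 by apply: (cvgr_lt _ lim).
  move=> /nbhs_ballP[r /= r0 hr].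
  have {}hr z : `|z - u| < r -> dotp (gradient V z) w < 0.
    by move=> zu; apply: hr; rewrite -ball_normE /= distrC.
  have w1 : 0 < `|w| + 1 by rewrite ltr_wpDl.
  pose s : R := r / 2 / (`|w| + 1).
  have s0 : 0 < s by rewrite !divr_gt0.
  have sw : s * `|w| <= r / 2.
    have : s * (`|w| + 1) = r / 2 by rewrite divfK // gt_eqF.
    by nra.
  suff Kw : closure S (u + s *: w).
    have := normal _ Kw; rewrite addrAC subrr add0r dotpZr.
    by rewrite pmulr_rle0.
  apply/closure_ballE => e e0.
  have er : 0 < Num.min e (r / 2) by rewrite lt_min e0 divr_gt0.
  have [b Sb] := Ku _ er; rewrite lt_min => /andP[be br].
  exists (b + s *: w); last by rewrite opprD addrACA subrr addr0.
  apply: (S_ext b) => // t /andP[t0 t1].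
  rewrite addrAC subrr add0r scalerA.
  have [->|tn0] := eqVneq t 0; first by rewrite mul0r scale0r addr0 SV.
  have ts0 : 0 < t * s by rewrite mulr_gt0 // lt0r tn0.
  apply: le_lt_trans (SV _ Sb); apply: ltW.
  rewrite -[X in _ < V X](addrK ((t * s) *: w) b) -scalerN.
  have tw : t * s * `|w| <= r / 2 by rewrite -mulrA; nra.
  apply: (@increasing_in_ball u r) => //.
  - rewrite addrAC; apply: le_lt_trans (ler_normD _ _) _.
    by rewrite normrZ gtr0_norm //; lra.
  - by rewrite scalerN addrK; lra.
  by move=> q /hr; rewrite dotpNr oppr_gt0.
pose c : R := dotp nu gr / dotp gr gr.
have cE : c * dotp gr gr = dotp nu gr by rewrite divfK // gt_eqF.
have c0 : 0 <= c.
  rewrite divr_ge0 ?dotp_ge0 //.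
  by have := inward (- gr); rewrite !dotpNr oppr_lt0 oppr_le0; apply.
pose nu' := nu - c *: gr.
have orth : dotp gr nu' = 0 by rewrite /nu' dotpBr dotpZr cE dotpC subrr.
have nu'0 : nu' = 0.
  apply/eqP; rewrite -dotp_eq0 eq_le dotp_ge0 andbT; apply/ler_addgt0Pr => e e0.
  have d0 : 0 < dotp nu gr + 1 by rewrite ltr_wpDl // -cE mulr_ge0 // ltW.
  pose t : R := e / (dotp nu gr + 1).
  have t0 : 0 < t by rewrite divr_gt0.
  have tE : t * (dotp nu gr + 1) = e by rewrite divfK // gt_eqF.
  have := inward (nu' - t *: gr).
  rewrite (dotpBr gr nu') (dotpBr nu nu') (dotpZr t gr) (dotpZr t nu) orth sub0r oppr_lt0.
  rewrite mulr_gt0 // => /(_ isT).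
  have -> : dotp nu nu' = dotp nu' nu'.
    have -> : dotp nu' nu' = dotp nu nu' - c * dotp gr nu' by rewrite -dotpZl -dotpBl.
    by rewrite orth mulr0 subr0.
  by rewrite add0r; lra.
have nuE : nu = c *: gr by apply/eqP; rewrite -subr_eq0; apply/eqP.
exists c => //; rewrite lt0r c0 andbT; apply: contra nu0 => /eqP c00.
by rewrite nuE c00 scale0r.
Qed.
End Convexity.

(** * Projection and the maximum principle *)

(** The point of K closest to x; comparing it with the points of the segment
    to any k in K gives the normality, and normality makes P a contraction. *)
Lemma convex_projection (R : realType) (n : nat) (K : set 'rV[R]_n) :
  K !=set0 -> compact K -> convex_set K -> exists P : 'rV[R]_n -> 'rV[R]_n,
    [/\ forall x, K (P x), forall x, outward_normal K (P x) (x - P x) & continuous P].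
Proof.
move=> K0 cK convK.
have sq_cont (x : 'rV[R]_n) : continuous (fun k : 'rV[R]_n => dotp (x - k) (x - k)).
  move=> k; have h : (x - (k' : 'rV[R]_n)) @[k' --> k] --> x - k.
    apply: (@cvgB _ _ _ (nbhs k) (nbhs_filter k) (fun=> x) id); last exact: cvg_id.
    exact: (@cvg_cst _ x _ _ (nbhs_filter k)).
  exact: (cvg_dotp h h).
have /choice[P hP] : forall x : 'rV[R]_n, exists p : 'rV[R]_n,
    K p /\ forall k, K k -> dotp (x - p) (x - p) <= dotp (x - k) (x - k).
  move=> x; have [p pK hp] := EVT_min_rV K0 cK (continuous_subspaceT (sq_cont x)).
  exists p; split; first by move: pK; rewrite inE.
  by move=> k Kk; apply: hp; rewrite inE.
have normal x k : K k -> dotp (x - P x) (k - P x) <= 0.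
  move=> Kk; have [Kp min] := hP x.
  set p := P x in Kp min *.
  have B0 : 0 <= dotp (k - p) (k - p) by exact: dotp_ge0.
  have var (t : R) : 0 < t -> t <= 1 -> 2 * dotp (x - p) (k - p) <= t * dotp (k - p) (k - p).
    move=> t0 t1; have := min _ (convK p k t Kp Kk _); rewrite (ltW t0) t1 => /(_ isT).
    have -> : x - (p + t *: (k - p)) = (x - p) - t *: (k - p) by rewrite opprD addrA.
    rewrite dotp_subZ => h.
    rewrite -(ler_pM2l t0); lra.
  rewrite leNgt; apply/negP => pos.
  have B1 : 0 < dotp (k - p) (k - p) + 1 by rewrite ltr_wpDl.
  set A := dotp _ _ in pos var *; set B := dotp _ _ in B0 B1 var *.
  pose t : R := Num.min 1 (A / (B + 1)).
  have t0 : 0 < t by rewrite lt_min ltr01 divr_gt0.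
  have t1 : t <= 1 by rewrite ge_min lexx.
  have tA : t * (B + 1) <= A by rewrite -ler_pdivlMr // ge_min lexx orbT.
  have := var t t0 t1; lra.
exists P; split => [x|x k|x]; [exact: (hP x).1|exact: normal|].
have contraction y : dotp (P x - P y) (P x - P y) <= dotp (x - y) (x - y).
  have h1 := normal x (P y) (hP y).1; have h2 := normal y (P x) (hP x).1.
  have key : dotp (x - y) (P x - P y) - dotp (P x - P y) (P x - P y) =
      - dotp (x - P x) (P y - P x) - dotp (y - P y) (P x - P y).
    have -> : - dotp (x - P x) (P y - P x) = dotp (x - P x) (P x - P y).
      by rewrite -dotpNr opprB.
    by rewrite -!dotpBl; congr dotp; apply/rowP => j; rewrite !mxE; ring.
  have := dotp_amgm (x - y) (P x - P y); lra.
apply/(@cvgrPdist_lt _ _ _ _ (nbhs_filter x)) => e e0.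
have lim : dotp (x - y) (x - y) @[y --> x] --> 0.
  have e1 : dotp (x - x) (x - x) = 0 by rewrite subrr dotp0r.
  by rewrite -[X in _ --> X]e1; exact: sq_cont.
have e2 : 0 < e ^+ 2 by rewrite exprn_gt0.
have : \forall y \near x, dotp (x - y) (x - y) < e ^+ 2 by apply: (cvgr_lt _ lim).
apply: (@filterS _ _ (nbhs_filter x)) => y hy.
rewrite -(ltr_pXn2r (ltn0Sn 1)) ?nnegrE ?normr_ge0 ?ltW //.
exact: le_lt_trans (norm_sq_le_dotp _) (le_lt_trans (contraction y) hy).
Qed.

Section Invariance.
Variables (R : realType) (n : nat) (T : R).

Lemma quotient_positive (Z dZ : R -> 'rV[R]_n) (nu : 'rV[R]_n) (t : R) :
  derivative_on T Z dZ -> t \in `[0, T] -> 0 < dotp nu (dZ t) ->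
  exists2 d : R, 0 < d & forall s, s \in `[0, T] -> `|s - t| < d -> s != t ->
    0 < (s - t) * dotp nu (Z s - Z t).
Proof.
move=> hZ tT pos.
have lim : dotp nu ((s - t)^-1 *: (Z s - Z t)) @[s --> within (`[0, T] `\ t) (nbhs t)]
    --> dotp nu (dZ t).
  exact: (cvg_dotp (cvg_cst nu) (hZ t tT)).
have : \forall s \near within (`[0, T] `\ t) (nbhs t),
    0 < dotp nu ((s - t)^-1 *: (Z s - Z t)) by apply: (cvgr_gt _ lim).
rewrite near_withinE => /nbhs_ballP[d /= d0 hd]; exists d => // s sT st snt.
have := hd s; rewrite -ball_normE /= distrC => /(_ st) h.
have {h} : 0 < dotp nu ((s - t)^-1 *: (Z s - Z t)) by apply: h; split => //; apply/eqP.
rewrite dotpZr => h.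
have st0 : s - t != 0 by rewrite subr_eq0.
have sq : 0 < (s - t) ^+ 2 by rewrite lt0r sqrf_eq0 st0 sqr_ge0.
by have := mulr_gt0 sq h; rewrite expr2 -mulrA mulVKf.
Qed.

(** Consider the time s0 where x is farthest from K.  Periodicity allows
    s0 < T, and replaces the left derivative at 0 by that at T. *)
Lemma periodic_invariance (X Y : R -> 'rV[R]_n) (psi P : 'rV[R]_n -> 'rV[R]_n)
    (F : R -> 'rV[R]_n -> 'rV[R]_n) (K : set 'rV[R]_n) :
  0 < T ->
  derivative_on T X (psi \o Y) -> derivative_on T Y (fun t => F t (X t)) ->
  {within `[0, T], continuous X} -> X 0 = X T -> Y 0 = Y T ->
  (forall x, K (P x)) -> (forall x, outward_normal K (P x) (x - P x)) -> continuous P ->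
  (forall nu y, 0 < dotp nu y -> 0 < dotp nu (psi y)) ->
  (forall t x, t \in `[0, T] -> x != P x -> 0 < dotp (x - P x) (F t x)) ->
  forall t, t \in `[0, T] -> X t = P (X t).
Proof.
move=> T0 dX dY Xc X0T Y0T KP normal Pc psi_pos F_out t tT.
apply/eqP; apply: contrapT => /negP Xt.
pose D s := dotp (X s - P (X s)) (X s - P (X s)).
have Dc : {within `[0, T], continuous D}.
  apply/subspace_continuousP => s sT.
  have Xs : X s' @[s' --> within `[0, T] (nbhs s)] --> X s.
    by move/subspace_continuousP : Xc; apply.
  have PXs : P (X s') @[s' --> within `[0, T] (nbhs s)] --> P (X s).
    exact: (@cvg_comp _ _ _ X P _ _ _ Xs (Pc _)).
  exact: (cvg_dotp (cvgB Xs PXs) (cvgB Xs PXs)).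
have o_in : 0 \in `[0, T] by rewrite in_itv /= lexx ltW.
have T_in : T \in `[0, T] by rewrite in_itv /= lexx ltW.
have [s0 [s0T s0_lt Dmax]] : exists s0, [/\ s0 \in `[0, T], s0 < T &
    forall s, s \in `[0, T] -> D s <= D s0].
  have [m mT Dm] := EVT_max (ltW T0) Dc.
  have [mlt|Tm] := ltP m T; first by exists m.
  have mE : m = T by apply/eqP; rewrite eq_le Tm andbT; move: mT; rewrite in_itv /= => /andP[].
  by exists 0; split => // s sT; rewrite /D X0T -/(D T) -mE; apply: Dm.
have s0_ge : 0 <= s0 by move: s0T; rewrite in_itv /= => /andP[].
pose nu := X s0 - P (X s0).
have nunu : 0 < dotp nu nu.
  by apply: lt_le_trans (Dmax t tT); rewrite dotp_gt0 subr_eq0.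
have Xs0 : X s0 != P (X s0) by rewrite -subr_eq0 -dotp_gt0.
have below s : s \in `[0, T] -> dotp nu (X s - X s0) <= 0.
  move=> sT; have := normal (X s0) (P (X s)) (KP _); rewrite -/nu.
  have := dotp_amgm nu (X s - P (X s)); have := Dmax s sT; rewrite /D -/nu.
  have -> : X s - X s0 = (X s - P (X s)) + (P (X s) - P (X s0)) - nu.
    by rewrite /nu; apply/rowP => j; rewrite !mxE; ring.
  rewrite (dotpBr nu _ nu) (dotpDr nu (X s - P (X s)) (P (X s) - P (X s0))); lra.
have upward : dotp nu (psi (Y s0)) <= 0.
  rewrite leNgt; apply/negP => pos.
  have [d d0 hd] := quotient_positive dX s0T pos.
  pose e : R := Num.min (d / 2) (T - s0).
  have e0 : 0 < e by rewrite lt_min divr_gt0 // subr_gt0.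
  have ed : e <= d / 2 by rewrite ge_min lexx.
  have eT : e <= T - s0 by rewrite ge_min lexx orbT.
  have sT : s0 + e \in `[0, T] by rewrite in_itv /=; lra.
  have := hd _ sT; rewrite addrAC subrr add0r gtr0_norm // => /(_ _ _).
  move=> h; have {h} : 0 < e * dotp nu (X (s0 + e) - X s0).
    by apply: h; [lra|rewrite -subr_eq0 addrAC subrr add0r gt_eqF].
  by rewrite pmulr_rgt0 // ltNge below.
have downward : 0 <= dotp nu (psi (Y s0)).
  rewrite leNgt; apply/negP => neg.
  have [s1 [s1T s1_gt Xs1 Ys1]] : exists s1, [/\ s1 \in `[0, T], 0 < s1, X s1 = X s0 & Y s1 = Y s0].
    have [s00|s00] := eqVneq s0 0; first by exists T; rewrite s00.
    by exists s0; rewrite lt0r s00.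
  have neg1 : 0 < dotp (- nu) ((psi \o Y) s1) by rewrite dotpNl /= Ys1 oppr_gt0.
  have [d d0 hd] := quotient_positive dX s1T neg1.
  pose e : R := Num.min (d / 2) s1.
  have e0 : 0 < e by rewrite lt_min divr_gt0.
  have ed : e <= d / 2 by rewrite ge_min lexx.
  have es : e <= s1 by rewrite ge_min lexx orbT.
  have sT : s1 - e \in `[0, T] by move: s1T; rewrite !in_itv /=; lra.
  have := hd _ sT; rewrite addrAC subrr add0r normrN gtr0_norm // => h.
  have {h} : 0 < - e * dotp (- nu) (X (s1 - e) - X s1).
    by apply: h; [lra|rewrite -subr_eq0 addrAC subrr add0r oppr_eq0 gt_eqF].
  by rewrite dotpNl mulrNN Xs1 pmulr_rgt0 // ltNge below.
have psi0 : dotp nu (psi (Y s0)) = 0 by apply/eqP; rewrite eq_le upward.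
have Y0 : dotp nu (Y s0) = 0.
  have [neg|pos|//] := ltrgtP (dotp nu (Y s0)) 0.
    have : 0 < dotp (- nu) (Y s0) by rewrite dotpNl oppr_gt0.
    by move=> /psi_pos; rewrite dotpNl psi0 oppr0 ltxx.
  by have := psi_pos _ _ pos; rewrite psi0 ltxx.
have [d d0 hd] := quotient_positive dY s0T (F_out s0 (X s0) s0T Xs0).
pose s1 : R := Num.min (s0 + d / 2) T.
have s01 : s0 < s1 by rewrite lt_min s0_lt ltrDl divr_gt0.
have s1T : s1 <= T by rewrite ge_min lexx orbT.
have s1d : s1 <= s0 + d / 2 by rewrite ge_min lexx.
have inT s : s0 <= s <= s1 -> s \in `[0, T] by rewrite in_itv /=; lra.
have Xpos s : s0 < s <= s1 -> 0 < dotp nu (psi (Y s)).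
  move=> ss; apply: psi_pos.
  have sT : s \in `[0, T] by apply: inT; lra.
  have : 0 < (s - s0) * dotp nu (Y s - Y s0).
    by apply: hd => //; [rewrite ltr_norml; lra|rewrite gt_eqF //; lra].
  by rewrite pmulr_rgt0 ?dotpBr ?Y0 ?subr0 //; lra.
(* A function whose left difference quotients are positive on ]s0, s1]
   attains its minimum over the interval at s0 only, which replaces the mean
   value theorem for the one-sided derivatives at hand. *)
have left_lower m : s0 < m <= s1 -> exists2 s, s0 <= s <= s1 & dotp nu (X s) < dotp nu (X m).
  move=> mm; have mT : m \in `[0, T] by apply: inT; lra.
  have [r r0 hr] := quotient_positive dX mT (Xpos m mm).
  pose e : R := Num.min (r / 2) (m - s0).
  have e0 : 0 < e by rewrite lt_min divr_gt0 // subr_gt0; lra.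
  have er : e <= r / 2 by rewrite ge_min lexx.
  have es : e <= m - s0 by rewrite ge_min lexx orbT.
  have ss : s0 <= m - e <= s1 by lra.
  exists (m - e) => //.
  have := hr _ (inT _ ss); rewrite addrAC subrr add0r normrN gtr0_norm // => h.
  have {h} : 0 < - e * dotp nu (X (m - e) - X m).
    by apply: h; [lra|rewrite -subr_eq0 addrAC subrr add0r oppr_eq0 gt_eqF].
  by rewrite mulNr -mulrN pmulr_rgt0 // -dotpNr opprB dotpBr subr_gt0.
have hc : {within `[s0, s1], continuous (fun s => dotp nu (X s))}.
  have sub : `[s0, s1]%classic `<=` `[0, T].
    by move=> s /=; rewrite in_itv /= => /inT.
  apply: (continuous_subspaceW sub); apply/subspace_continuousP => s sT.
  apply: (cvg_dotp (cvg_cst nu)).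
  by move/subspace_continuousP : Xc; apply.
have [m mI hmin] := EVT_min (ltW s01) hc.
have {}mI : s0 <= m <= s1 by move: mI; rewrite in_itv.
have [m_gt|] := ltP s0 m.
  have [|s ss] := left_lower m; first lra.
  by rewrite ltNge hmin // in_itv.
move=> ms0; have mE : m = s0 by lra.
have [|s ss] := left_lower s1; first by lra.
have h1 := hmin s; rewrite in_itv ss in h1; have {}h1 := h1 isT.
have h2 := below s1 (inT s1 _).
move: h1 h2; rewrite mE dotpBr; lra.
Qed.
End Invariance.

(** * Assembling the solution *)

Section Assembly.
Variables (R : realType) (n : nat).

Lemma dotp_le_norm_sq (x : 'rV[R]_n) : dotp x x <= n%:R * `|x| ^+ 2.
Proof.
rewrite /dotp; have -> : n%:R * `|x| ^+ 2 = \sum_(i < n) `|x| ^+ 2.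
  by rewrite sumr_const card_ord mulr_natl.
apply: ler_sum => i _; rewrite -expr2 -[X in X <= _]real_normK ?num_real //.
by rewrite lerXn2r ?nnegrE ?norm_coord_le.
Qed.

(** By the arithmetic-geometric mean inequality, half of |x|^2 survives the
    perturbation g; it dominates |x| - 1/2. *)
Lemma dotp_perturbed_ge (g x : 'rV[R]_n) (B : R) : `|g| <= B ->
  `|x| - (1 + n%:R * B ^+ 2) / 2 <= dotp (g + x) x.
Proof.
move=> gB; rewrite dotpDl.
have gg : dotp g g <= n%:R * B ^+ 2.
  apply: le_trans (dotp_le_norm_sq g) _; rewrite ler_wpM2l //.
  by rewrite lerXn2r ?nnegrE // (le_trans _ gB).
have := dotp_amgm (- g) x; rewrite !dotpNl dotpNr opprK => am.
have xx := norm_sq_le_dotp x.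
have sq : 0 <= (`|x| - 1) ^+ 2 by rewrite sqr_ge0.
have {}sq : 2 * `|x| - 1 <= `|x| ^+ 2 by move: sq; rewrite sqrrB1; lra.
lra.
Qed.

Lemma continuous_within_comp (U V W : topologicalType) (S : set V) (h : U -> V) (k : V -> W) :
  continuous h -> (forall u, S (h u)) -> {within S, continuous k} -> continuous (k \o h).
Proof.
move=> hc hS /subspace_continuousP kc u.
apply: (@cvg_comp _ _ _ h k _ (within S (nbhs (h u)))); last exact: kc.
move=> N NS; have := hc u _ NS; rewrite /nbhs /=.
by apply: filterS => u'; apply.
Qed.

(** The nearest point of [0, T]: it extends a field given for t in [0, T] to a
    field continuous for all t. *)
Definition clip (T t : R) : R := Num.max 0 (Num.min t T).

Lemma clip_in T t : 0 < T -> clip T t \in `[0, T].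
Proof.
by move=> T0; rewrite in_itv /= le_max lexx /= ge_max (ltW T0) ge_min lexx orbT.
Qed.

Lemma clip_id T t : t \in `[0, T] -> clip T t = t.
Proof.
by rewrite in_itv /= => /andP[t0 tT]; rewrite /clip min_l // max_r.
Qed.

Lemma clip_continuous T : continuous (clip T).
Proof.
move=> t; apply: (@continuous_max R _ (fun=> 0) (fun s => Num.min s T) t).
  exact: (@cvg_cst _ _ _ _ (nbhs_filter t)).
apply: (@continuous_min R _ id (fun=> T) t); first exact: cvg_id.
exact: (@cvg_cst _ _ _ _ (nbhs_filter t)).
Qed.

(** V increases in the direction of its gradient, so u is not interior. *)
Lemma zero_in_boundary (V : 'rV[R]_n -> R) (u : 'rV[R]_n) : class_C2 V ->
  (forall u, V u = 0 -> gradient V u != 0) -> V u = 0 ->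
  boundary [set x | V x <= 0] u.
Proof.
move=> V_C2 V_reg Vu; split; first by apply: subset_closure; rewrite /= Vu.
move=> /nbhs_ballP[e /= e0 he].
have [r r0 hr] := transversal_ball V_C2 V_reg Vu.
have g0 : 0 < `|gradient V u| by rewrite normr_gt0 V_reg.
pose m : R := Num.min e r / 2.
have m0 : 0 < m by rewrite divr_gt0 // lt_min e0.
have me : m * 2 <= e by rewrite divfK // ge_min lexx.
have mr : m * 2 <= r by rewrite divfK // ge_min lexx orbT.
pose s : R := m / `|gradient V u|.
have s0 : 0 < s by rewrite divr_gt0.
have nE : `|u + s *: gradient V u - u| = m.
  by rewrite addrAC subrr add0r normrZ gtr0_norm // divfK // gt_eqF.
have : V (u + s *: gradient V u) <= 0.
  by apply: he; rewrite -ball_normE /= distrC nE; lra.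
rewrite leNgt => /negP; apply; rewrite -[X in X < _]Vu.
apply: (@increasing_in_ball R n V V_C2 u r) => //; last by rewrite nE; lra.
by rewrite subrr normr0.
Qed.

Section RadialHomeomorphism.
Variables (phi psi : 'rV[R]_n -> 'rV[R]_n) (A : 'rV[R]_n -> R).
Hypotheses (psiK : cancel psi phi) (phi0 : phi 0 = 0).
Hypothesis phiE : forall xi, xi != 0 -> phi xi = A xi *: xi.
Hypothesis A_gt0 : forall xi, xi != 0 -> 0 < A xi.

(** psi y is a positive multiple of y. *)
Lemma radial_inverse_pos (nu y : 'rV[R]_n) : 0 < dotp nu y -> 0 < dotp nu (psi y).
Proof.
rewrite -{1}[y]psiK; have [->|xi0] := eqVneq (psi y) 0.
  by rewrite phi0 dotp0r ltxx.
by rewrite phiE // dotpZr pmulr_rgt0 // A_gt0.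
Qed.

(** Since psi y and y are parallel, their product is the product of their
    lengths, and psi y has length at least 1 unless y is in the image of the
    unit ball under phi. *)
Lemma radial_inverse_coercive (P : R) (y : 'rV[R]_n) : 0 <= P ->
  (forall v, `|v| <= 1 -> `|phi v| <= P) -> `|y| - P <= dotp (psi y) y.
Proof.
move=> P0 phiP; rewrite -{1 3}[y]psiK.
have [->|xi0] := eqVneq (psi y) 0.
  by rewrite phi0 dotp0r normr0 sub0r oppr_le0.
have A0 := A_gt0 xi0.
have [small|large] := leP `|psi y| 1.
  have := phiP _ small; rewrite phiE // dotpZr => h.
  have : 0 <= A (psi y) * dotp (psi y) (psi y) by rewrite mulr_ge0 ?dotp_ge0 // ltW.
  by rewrite -subr_le0 in h; apply: le_trans.
rewrite phiE // dotpZr normrZ gtr0_norm //.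
have h1 := norm_sq_le_dotp (psi y).
have h2 : A (psi y) * `|psi y| <= A (psi y) * dotp (psi y) (psi y).
  rewrite ler_pM2l //; apply: le_trans h1; rewrite expr2 ler_peMr //; exact: ltW.
lra.
Qed.
End RadialHomeomorphism.
End Assembly.

Unset Implicit Arguments.

Theorem corollary3p2 (R : realType) (n : nat) (T : R)
    (phi : 'rV[R]_n -> 'rV[R]_n) (A : 'rV[R]_n -> R)
    (f : R -> 'rV[R]_n -> 'rV[R]_n) (V : 'rV[R]_n -> R)
    (n_ge1 : (1 <= n)%N) (T_gt0 : 0 < T)
    (phi_homeo : homeomorphism phi)
    (phiE : forall xi, xi != 0 -> phi xi = A xi *: xi)
    (phi0 : phi 0 = 0)
    (A_gt0 : forall xi, xi != 0 -> 0 < A xi)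
    (A_cont : {within ~` [set 0], continuous A})
    (f_cont : {within `[0, T] `*` setT, continuous (fun p => f p.1 p.2)})
    (V_C2 : class_C2 V)
    (V_regular : forall u, V u = 0 -> gradient V u != 0) :
  let D := [set x | V x <= 0] in
  D !=set0 ->
  bounded_set D ->
  (forall t u, t \in `[0, T] -> boundary D u ->
     0 <= dotp (gradient V u) (f t u) /\
     forall y, dotp (gradient V u) y = 0 -> 0 <= dotp (y *m hessian V u) y) ->
  exists x : R -> 'rV[R]_n,
    periodic_solution T phi f x /\
    forall t, t \in `[0, T] -> D (x t).
Proof.
move=> D D0 Dbd Hbd.
have [phic [g [phiK gK] gc]] := phi_homeo.
have o_in : 0 \in `[0, T] by rewrite in_itv /= lexx ltW.
have V_tangent u y : V u = 0 ->
    dotp (gradient V u) y = 0 -> 0 <= dotp (y *m hessian V u) y.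
  by move=> Vu; have [_] := Hbd 0 u o_in (zero_in_boundary V_C2 V_regular Vu); apply.
have [K [K0 Kcl KD Kconv Knormal]] := convex_component V_C2 V_regular V_tangent D0.
have Kc : compact K.
  apply: bounded_closed_compact => //.
  case: Dbd => M [Mr hM]; exists M; split => // r Mr' x Kx.
  by apply: (hM r Mr'); apply: KD.
have [P [PK Pnormal Pc]] := convex_projection K0 Kc Kconv.
have [B0 [_ hB0]] : bounded_set ((fun p : R * 'rV[R]_n => f p.1 p.2 - p.2) @` (`[0, T] `*` K)).
  apply: compact_bounded; apply: continuous_compact; last first.
    by apply: compact_setX => //; exact: segment_compact.
  have sub : `[0, T]%classic `*` K `<=` `[0, T] `*` [set: 'rV[R]_n] by move=> p [].
  apply/subspace_continuousP => p pK; apply: cvgB.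
    by move/(continuous_subspaceW sub)/subspace_continuousP: f_cont; apply.
  by apply: cvg_within_filter; exact: cvg_snd.
pose B : R := `|B0| + 1.
have B_ge0 : 0 <= B by rewrite addr_ge0.
(* G takes its values on the compact set [0, T] x K, hence is bounded; adding
   x makes the field coercive. *)
pose G t x := f (clip T t) (P x) - P x.
have GB t x : `|G t x| <= B.
  apply: (hB0 B); first by rewrite (le_lt_trans (ler_norm B0)) // ltrDl.
  by exists (clip T t, P x) => //; split => /=; [exact: clip_in|exact: PK].
pose F t x := G t x + x.
have FE t x : F t x = f (clip T t) (P x) + (x - P x) by rewrite /F /G addrAC addrA.
have Fc : continuous (fun p : R * 'rV[R]_n => F p.1 p.2).
  move=> p.
  have c1 : clip T p'.1 @[p' --> p] --> clip T p.1.
    exact: (@cvg_comp _ _ _ fst (clip T) _ _ _ cvg_fst (@clip_continuous R T p.1)).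
  have c2 : P p'.2 @[p' --> p] --> P p.2.
    exact: (@cvg_comp _ _ _ snd P _ _ _ cvg_snd (Pc _)).
  have fc : f (clip T p'.1) (P p'.2) @[p' --> p] --> f (clip T p.1) (P p.2).
    apply: (@continuous_within_comp _ _ _ (`[0, T] `*` setT)
      (fun p : R * 'rV[R]_n => (clip T p.1, P p.2)) (fun p => f p.1 p.2)) => //.
      move=> q.
      have c1' : clip T p'.1 @[p' --> q] --> clip T q.1.
        exact: (@cvg_comp _ _ _ fst (clip T) _ _ _ cvg_fst (@clip_continuous R T q.1)).
      have c2' : P p'.2 @[p' --> q] --> P q.2.
        exact: (@cvg_comp _ _ _ snd P _ _ _ cvg_snd (Pc _)).
      exact: (cvg_pair c1' c2').
    by move=> q; split => //=; exact: clip_in.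
  exact: (cvgD (cvgB fc c2) cvg_snd).
have [P1 hP1] := continuous_bounded_on_balls 1 phic.
pose C1 : R := (1 + n%:R * B ^+ 2) / 2.
have C1_ge0 : 0 <= C1 by rewrite divr_ge0 // addr_ge0 // mulr_ge0 // exprn_ge0.
pose C : R := C1 + `|P1|.
have C_ge0 : 0 <= C by rewrite addr_ge0.
have g_coercive y : `|y| - C <= dotp (g y) y.
  have h := @radial_inverse_coercive R n phi g A gK phi0 phiE A_gt0 `|P1| y (normr_ge0 _)
    (fun v hv => le_trans (hP1 v hv) (ler_norm _)).
  by apply: le_trans h; rewrite lerB // lerDr.
have F_coercive t x : `|x| - C <= dotp (F t x) x.
  by apply: le_trans (dotp_perturbed_ge x (GB t x)); rewrite lerB // lerDl.
have F_bound t x : `|F t x| <= B + `|x|.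
  by apply: le_trans (ler_normD _ _) _; rewrite lerD.
have [X [Y [[dX dY] Xc Yc X0T Y0T]]] :=
  periodic_system T_gt0 C_ge0 B_ge0 gc Fc g_coercive F_coercive F_bound.
(* The vector x - P x is normal to K at P x, hence a positive multiple of the
   gradient of V there, and the sign hypothesis on f applies. *)
have F_out t x : t \in `[0, T] -> x != P x -> 0 < dotp (x - P x) (F t x).
  move=> tT xP; have nu0 : x - P x != 0 by rewrite subr_eq0.
  have [Vu [c c0 nuE]] := Knormal (P x) (x - P x) (PK x) nu0 (Pnormal x).
  have [fpos _] := Hbd t (P x) tT (zero_in_boundary V_C2 V_regular Vu).
  rewrite FE clip_id // dotpDr ltr_wpDl ?dotp_gt0 //.
  by rewrite nuE dotpZl mulr_ge0 // ltW.
have XP := periodic_invariance T_gt0 dX dY Xc X0T Y0T PK Pnormal Pc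
  (fun nu y => @radial_inverse_pos R n phi g A gK phi0 phiE A_gt0 nu y) F_out.
exists X; split; last by move=> t tT; rewrite (XP t tT); apply: KD; apply: PK.
exists (g \o Y), (fun t => F t (X t)); split => //.
- split => //; apply/subspace_continuousP => t tT.
  have Yt : Y s @[s --> within `[0, T] (nbhs t)] --> Y t.
    by move/subspace_continuousP : Yc; apply.
  exact: (@cvg_comp _ _ _ Y g _ _ _ Yt (gc _)).
- have -> : phi \o (g \o Y) = Y by apply/funext => t /=; rewrite gK.
  split => //; apply/subspace_continuousP => t tT.
  have Xt : X s @[s --> within `[0, T] (nbhs t)] --> X t.
    by move/subspace_continuousP : Xc; apply.
  have tXt : (s, X s) @[s --> within `[0, T] (nbhs t)] --> (t, X t).
    have idt : s @[s --> within `[0, T] (nbhs t)] --> t by exact: cvg_within.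
    exact: (cvg_pair idt Xt).
  exact: (@cvg_comp _ _ _ (fun s => (s, X s)) (fun p => F p.1 p.2) _ _ _ tXt (Fc (t, X t))).
- by move=> t tT; rewrite FE -(XP t tT) clip_id // subrr addr0.
- by rewrite /= Y0T.
Qed.
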